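(* Let $G$ be a simple graph with subgraphs $G_1$ and $G_2$ such that $G = G_1 \cup G_2$ and $G_1 \cap G_2$ consists of a single edge $e$ of $G$ together with its two end vertices. If $\theta(G_1) = n_1$ and $\theta(G_2) = n_2$, then $\max\{n_1, n_2\} \le \theta(G) \le n_1 + n_2 - 1$.
   Context: All graphs are simple. A planar decomposition of a graph $G$ is a collection of spanning subgraphs $G_1,\dots,G_k$ of $G$, each planar, whose edge sets are pairwise disjoint and have union $E(G)$. The thickness $\theta(G)$ is the minimum number $k$ of planar spanning subgraphs into which $G$ can be decomposed in this way. The union $G_1\cup G_2$ has vertex set $V(G_1)\cup V(G_2)$ and edge set $E(G_1)\cup E(G_2)$; the intersection is defined analogously. Such a $G$ is called the edge-amalgamation of $G_1$ and $G_2$ on $e$. *)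

(* Defs.v *)
From HB Require Import structures.
From mathcomp Require Import all_boot all_order all_algebra.
From mathcomp Require Import all_classical all_reals all_analysis.
From mathcomp Require Import lra.

Set Implicit Arguments.
Unset Strict Implicit.
Unset Printing Implicit Defensive.

Import Order.TTheory GRing.Theory Num.Theory.
Import numFieldNormedType.Exports.

(* A finite simple graph whose vertices are taken from T; since edges are
   2-element sets of vertices, Leibniz equality of graphs is equality of the
   vertex sets and of the edge sets. *)
Record sgraph (T : finType) := SGraph {
  vset : {set T};
  eset : {set {set T}};
  esetP : [forall e in eset, (#|e| == 2) && (e \subset vset)]
}.

Section Graphs.
Variable T : finType.
Implicit Types G H : sgraph T.

Lemma edge_card G (e : {set T}) : e \in eset G -> #|e| = 2.
Proof. by move=> eG; have /forall_inP/(_ e eG)/andP[/eqP] := esetP G. Qed.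

Lemma edge_sub G (e : {set T}) : e \in eset G -> e \subset vset G.
Proof. by move=> eG; have /forall_inP/(_ e eG)/andP[] := esetP G. Qed.

Definition subgraph H G : bool :=
  (vset H \subset vset G) && (eset H \subset eset G).

Definition spanning_subgraph H G : bool :=
  (vset H == vset G) && (eset H \subset eset G).

Lemma gunion_subproof G H :
  [forall e in eset G :|: eset H,
     (#|e| == 2) && (e \subset vset G :|: vset H)].
Proof.
apply/forall_inP => e; rewrite finset.in_setU => /orP[] eG; rewrite (edge_card eG) /=.
- exact: fintype.subset_trans (edge_sub eG) (finset.subsetUl _ _).
- exact: fintype.subset_trans (edge_sub eG) (finset.subsetUr _ _).
Qed.

Definition gunion G H : sgraph T := SGraph (gunion_subproof G H).

Lemma ginter_subproof G H :
  [forall e in eset G :&: eset H,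
     (#|e| == 2) && (e \subset vset G :&: vset H)].
Proof.
apply/forall_inP => e; rewrite finset.in_setI => /andP[eG eH].
by rewrite (edge_card eG) finset.subsetI (edge_sub eG) (edge_sub eH).
Qed.

Definition ginter G H : sgraph T := SGraph (ginter_subproof G H).

End Graphs.

Section Planarity.
Local Open Scope ring_scope.
Local Open Scope classical_set_scope.

(* A drawing of G in the plane: vertices are sent to distinct points, and every
   edge e to a simple arc, parametrized by [0, 1], joining the images of the
   two ends of e; the interior of an arc meets neither vertices nor the
   interior of another arc. *)
Record drawing (R : realType) (T : finType) (G : sgraph T)
    (pt : T -> R * R) (arc : {set T} -> R -> R * R) : Prop := Drawing {
  drawing_pt_inj : {in vset G &, injective pt};
  drawing_arc_cont : forall e, e \in eset G ->
    {within `[0, 1], continuous (arc e)};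
  drawing_arc_inj : forall e, e \in eset G ->
    {in `[0, 1]%R &, injective (arc e)};
  drawing_arc_ends : forall e, e \in eset G ->
    [set arc e 0; arc e 1] = pt @` [set` e];
  drawing_arc_pt : forall e x t, e \in eset G -> x \in vset G ->
    0 < t < 1 -> arc e t <> pt x;
  drawing_arc_arc : forall e e' s t, e \in eset G -> e' \in eset G ->
    e != e' -> 0 < s < 1 -> 0 < t < 1 -> arc e s <> arc e' t
}.

Definition planar (R : realType) (T : finType) (G : sgraph T) : Prop :=
  exists (pt : T -> R * R) (arc : {set T} -> R -> R * R), drawing G pt arc.

End Planarity.

Record planar_decomposition (R : realType) (T : finType) (G : sgraph T)
    (k : nat) (H : 'I_k -> sgraph T) : Prop := PlanarDecomposition {
  decomp_spanning : forall i, spanning_subgraph (H i) G;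
  decomp_planar : forall i, planar R (H i);
  decomp_disjoint : forall i j, i != j -> [disjoint eset (H i) & eset (H j)];
  decomp_cover : \bigcup_i eset (H i) = eset G
}.

Definition planar_decomposable (R : realType) (T : finType) (G : sgraph T)
    (k : nat) : Prop :=
  exists H : 'I_k -> sgraph T, planar_decomposition R G H.

Section ThicknessExists.
Variables (R : realType) (T : finType).
Implicit Types G : sgraph T.
Local Open Scope ring_scope.
Local Open Scope classical_set_scope.

Lemma planar1 G (e : {set T}) : eset G = [set e]%SET -> planar R G.
Proof.
move=> Ge; have eG : e \in eset G by rewrite Ge finset.set11.
case/eqP/cards2P: (edge_card eG) => u [v [uv euv]].
pose a (x : T) : R := (enum_rank x)%:R.
have a_inj : injective a.
  by move=> x y /eqP; rewrite eqr_nat => /eqP/val_inj/enum_rank_inj.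
pose pt (x : T) : R * R := (a x, if x \in e then 0 else 1).
pose arc (_ : {set T}) (t : R) : R * R := ((1 - t) * a u + t * a v, 0).
have auv : a v - a u != 0 by rewrite subr_eq0 (inj_eq a_inj) eq_sym.
have arcE t : (1 - t) * a u + t * a v = a u + t * (a v - a u) by lra.
have arc_inj s t : (1 - s) * a u + s * a v = (1 - t) * a u + t * a v -> s = t.
  by rewrite !arcE => /addrI/(mulIf auv).
have ue : u \in e by rewrite euv !inE eqxx.
have ve : v \in e by rewrite euv !inE eqxx orbT.
exists pt, arc; split.
- by move=> x y _ _ [/a_inj].
- move=> e' _; apply: continuous_subspaceT => t.
  rewrite /continuous_at /arc.
  suff ca : (1 - x) * a u + x * a v @[x --> t] --> (1 - t) * a u + t * a v.
    have c0 : (fun=> 0 : R) x @[x --> t] --> (0 : R) by exact: cvg_cst.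
    exact: cvg_pair ca c0.
  apply: cvgD; apply: cvgM; try exact: cvg_cst; last exact: cvg_id.
  by apply: cvgB; [exact: cvg_cst | exact: cvg_id].
- by move=> e' _ s t _ _ [] /arc_inj.
- move=> e'; rewrite Ge inE => /eqP ->.
  have arc0 : arc e 0 = pt u by rewrite /arc /pt ue; congr pair; lra.
  have arc1 : arc e 1 = pt v by rewrite /arc /pt ve; congr pair; lra.
  rewrite arc0 arc1; apply/seteqP; split => [p [->|->]|p [x /= + <-]].
  + by exists u.
  + by exists v.
  + by rewrite euv !inE => /orP[] /eqP ->; [left | right].
- move=> e' x t _ _; move=> /andP[t0 t1] [].
  case: ifPn => [|_ _ /eqP]; last by rewrite eq_sym oner_eq0.
  rewrite euv !inE => /orP[] /eqP -> h _.
  + have h0 : t = 0 by apply: arc_inj; rewrite h; lra.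
    by rewrite h0 ltxx in t0.
  + have h1 : t = 1 by apply: arc_inj; rewrite h; lra.
    by rewrite h1 ltxx in t1.
- by move=> e1 e2 s t; rewrite !Ge !inE => /eqP -> /eqP ->; rewrite eqxx.
Qed.

Lemma planar_decomposable_exists G :
  exists k, `[< planar_decomposable R G k >].
Proof.
exists #|eset G|; apply/asboolP.
have okP (i : 'I_#|eset G|) : [forall e in [set enum_val i]%SET,
    (#|e| == 2) && (e \subset vset G)].
  apply/forall_inP => e; rewrite inE => /eqP ->.
  have iG := enum_valP i.
  by rewrite (edge_card iG) (edge_sub iG).
exists (fun i => SGraph (okP i)); split => /=.
- by move=> i; rewrite /spanning_subgraph /= eqxx finset.sub1set enum_valP.
- by move=> i; apply: (@planar1 _ (enum_val i)).
- by move=> i j ij; rewrite disjoints1 inE (inj_eq enum_val_inj).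
- apply/finset.setP => e; apply/finset.bigcupP/idP => [[i _]|eG].
    by rewrite inE => /eqP ->; exact: enum_valP.
  by exists (enum_rank_in eG e); rewrite // inE enum_rankK_in.
Qed.

End ThicknessExists.

Definition thickness (R : realType) (T : finType) (G : sgraph T) : nat :=
  ex_minn (planar_decomposable_exists R G).

(* Main.v *)
Require Import Defs.
From mathcomp Require Import all_boot all_order all_algebra.
From mathcomp Require Import all_classical all_reals all_analysis.
From mathcomp Require Import ring lra zify.

(* The lower bound holds because planarity only depends on the edges. For the
   upper bound, decompose both graphs and merge the two parts that contain [e];
   what has to be shown is that the amalgam of two planar graphs on an edge
   [e = uv] is planar, starting from drawings with arbitrary continuous arcs.

   In a drawing, first make all arcs radial near [u] and [v]; the complement of
   the other arcs being open, [e] can then be redrawn as a simple polygonal line.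
   A map of the plane that collapses the first segment of this line, is injective
   elsewhere and fixes the rest of the line, slides [u] along [e]; iterating
   this, [e] becomes a straight segment. Opening this segment into a diamond and
   inverting the plane in the diamond brings the rest of the drawing to one side
   of [e]. With the two graphs on opposite sides of the same segment, the
   drawings can be superposed. *)

Set Implicit Arguments.
Unset Strict Implicit.
Unset Printing Implicit Defensive.

Import Order.TTheory GRing.Theory Num.Theory.
Import numFieldNormedType.Exports.

(** Several edges may spiral together around a common end, so that no segment issuing from it avoids
    the others; this is why arcs are made radial before [e] is redrawn. The straightening uses maps
    that are not homeomorphisms: apart from [e], the drawing meets the first segment only in the
    image of [u], so injectivity off that segment is enough. Other arcs may be moved by such a map,
    since they stay simple and keep apart. The rest of a drawing may surround [e]; the inversion is
    what brings it to one side. With the l1-norm the diamond is the unit disc, and the estimates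
    stay within linear arithmetic. The [- 1] comes from the amalgam: the class of [e] in [G1] and
    its class in [G2] share one planar layer. *)

Section ContinuityCombinators.
Local Open Scope ring_scope.
Local Open Scope classical_set_scope.
Context {R : realType} {S : topologicalType}.
Implicit Types f g : S -> R.

Lemma cts_cst {U : topologicalType} (c : U) : continuous (fun _ : S => c).
Proof. by move=> x; exact: cvg_cst. Qed.

Lemma ctsD f g : continuous f -> continuous g ->
  continuous (fun x => f x + g x).
Proof. by move=> cf cg x; apply: cvgD; [exact: cf|exact: cg]. Qed.

Lemma ctsN f : continuous f -> continuous (fun x => - f x).
Proof. by move=> cf x; apply: cvgN; exact: cf. Qed.

Lemma ctsM f g : continuous f -> continuous g ->
  continuous (fun x => f x * g x).
Proof. by move=> cf cg x; apply: cvgM; [exact: cf|exact: cg]. Qed.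

Lemma cts_norm f : continuous f -> continuous (fun x => `|f x|).
Proof. by move=> cf x; apply: cvg_norm; exact: cf. Qed.

Lemma cts_max f g : continuous f -> continuous g ->
  continuous (fun x => Num.max (f x) (g x)).
Proof. by move=> cf cg x; apply: continuous_max; [exact: cf|exact: cg]. Qed.

Lemma cts_min f g : continuous f -> continuous g ->
  continuous (fun x => Num.min (f x) (g x)).
Proof. by move=> cf cg x; apply: continuous_min; [exact: cf|exact: cg]. Qed.

Lemma cts_pair f g : continuous f -> continuous g ->
  continuous (fun x => (f x, g x)).
Proof. by move=> cf cg x; exact: cvg_pair (cf x) (cg x). Qed.

Lemma cts_fst (h : S -> R * R) : continuous h -> continuous (fun x => (h x).1).
Proof. by move=> ch x; apply: (cvg_comp _ _ (ch x)); exact: cvg_fst. Qed.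

Lemma cts_snd (h : S -> R * R) : continuous h -> continuous (fun x => (h x).2).
Proof. by move=> ch x; apply: (cvg_comp _ _ (ch x)); exact: cvg_snd. Qed.

Lemma cts_comp {U V : topologicalType} (h : U -> V) (k : S -> U) :
  continuous h -> continuous k -> continuous (fun x => h (k x)).
Proof. by move=> ch ck x; apply: (cvg_comp _ _ (ck x)); exact: ch. Qed.

Lemma cts_id : continuous (fun x : S => x).
Proof. by move=> x; exact: cvg_id. Qed.

Lemma cts_within_comp {U V : topologicalType} (X : set U) (h : U -> V)
    (k : S -> U) :
  {within X, continuous h} -> continuous k -> (forall s, X (k s)) ->
  continuous (fun x => h (k x)).
Proof.
move=> /subspace_continuousP ch ck kX x.
apply: (@cvg_comp _ _ _ k h _ (within X (nbhs (k x)))); last exact: ch.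
move=> P; rewrite /within /= => hP; change (nbhs x (k @^-1` P)).
have kP : nbhs x (k @^-1` [set y | X y -> P y]) := ck x _ hP.
by apply: filterS kP => y; apply; exact: kX.
Qed.

End ContinuityCombinators.

Ltac cts :=
  lazymatch goal with
  | |- forall x, @continuous_at _ _ x ?F =>
    lazymatch F with
    | fun x => x => exact: cts_id
    | fun x => (@?f x + @?g x)%R => apply: ctsD; cts
    | fun x => (- @?f x)%R => apply: ctsN; cts
    | fun x => (@?f x * @?g x)%R => apply: ctsM; cts
    | fun x => Num.norm (@?f x) => apply: cts_norm; cts
    | fun x => Order.max (@?f x) (@?g x) => apply: cts_max; cts
    | fun x => Order.min (@?f x) (@?g x) => apply: cts_min; cts
    | fun x => (@?f x, @?g x) => apply: cts_pair; cts
    | fun x => (@?f x).1 => apply: cts_fst; cts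
    | fun x => (@?f x).2 => apply: cts_snd; cts
    | @Algebra.opp _ => apply: ctsN; exact: cts_id
    | Algebra.add ?c => apply: ctsD; cts
    | GRing.mul ?c => apply: ctsM; cts
    | Order.max ?c => apply: cts_max; cts
    | Order.min ?c => apply: cts_min; cts
    | @Num.norm _ _ => apply: cts_norm; exact: cts_id
    | fst => apply: cts_fst; exact: cts_id
    | snd => apply: cts_snd; exact: cts_id
    | _ => first [assumption | exact: cts_cst | exact: cts_id]
    end
  | _ => idtac
  end.

(** * Arcs as point sets: concatenation, images, first hits *)

Section Arcs.
Local Open Scope ring_scope.
Local Open Scope classical_set_scope.
Variable R : realType.
Implicit Types (A B C : set (R * R)) (p q x y z : R * R).

(** Retraction of the line onto [0, 1]: precomposing with it makes a path on [0, 1] continuous on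
    the whole line, which avoids subspace topologies. *)
Definition clamp (t : R) : R := Num.max 0 (Num.min t 1).

Lemma clamp_cts : continuous clamp.
Proof. by rewrite /clamp; cts. Qed.

Lemma clamp_itv t : 0 <= clamp t <= 1.
Proof. by rewrite /clamp le_max lexx ge_max ler01 ge_min lexx orbT. Qed.

Lemma clampK t : 0 <= t <= 1 -> clamp t = t.
Proof.
by case/andP=> t0 t1; rewrite /clamp (min_idPl t1) (max_idPr t0).
Qed.

(** The arc is the point set, because surgery cuts, joins and maps sets; the parametrization stays
    existential. *)
Definition arc_between A p q := exists f : R -> R * R,
  [/\ continuous f,
      forall s t : R, 0 <= s <= 1 -> 0 <= t <= 1 -> f s = f t -> s = t,
      f 0 = p, f 1 = q & A = [set f t | t in `[0, 1]]].

Lemma arc_intro (f : R -> R * R) A p q :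
  continuous f ->
  (forall s t : R, 0 <= s <= 1 -> 0 <= t <= 1 -> f s = f t -> s = t) ->
  f 0 = p -> f 1 = q -> (forall t, 0 <= t <= 1 -> A (f t)) ->
  (forall z, A z -> exists2 t, 0 <= t <= 1 & z = f t) -> arc_between A p q.
Proof.
move=> cf fI f0 f1 fA Af; exists f; split => //; apply/seteqP; split => z.
  by move=> /Af[t t01 ->]; exists t; rewrite //= in_itv.
by move=> [t /= + <-]; rewrite in_itv; exact: fA.
Qed.

(** Precomposing with [clamp] keeps [f] inside [A] at every parameter, so later uses need no bound
    on [t]. *)
Lemma arc_elim A p q : arc_between A p q -> exists f : R -> R * R,
  [/\ continuous f,
      forall s t : R, 0 <= s <= 1 -> 0 <= t <= 1 -> f s = f t -> s = t,
      f 0 = p /\ f 1 = q, forall t, A (f t)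
    & forall z, A z -> exists2 t, 0 <= t <= 1 & z = f t].
Proof.
move=> [f [cf fI f0 f1 ->]].
exists (fun t => f (clamp t)); split.
- exact: cts_comp cf clamp_cts.
- by move=> s t s01 t01; rewrite !clampK //; exact: fI.
- by rewrite !clampK // ?lexx ?ler01.
- by move=> t; exists (clamp t); rewrite //= in_itv; exact: clamp_itv.
- by move=> z [t /=]; rewrite in_itv => t01 <-; exists t; rewrite ?clampK.
Qed.

Lemma arc_end A p q : arc_between A p q -> A q.
Proof. by move=> /arc_elim[f [_ _ [_ <-] fA _]]. Qed.

Lemma arc_neq A p q : arc_between A p q -> p <> q.
Proof.
move=> /arc_elim[f [_ fI [<- <-] _ _]] /fI h.
by have : (0 : R) = 1 by [apply: h; lra]; lra.
Qed.

Lemma arc_compact A p q : arc_between A p q -> compact A.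
Proof.
move=> [f [cf _ _ _ ->]]; apply: continuous_compact; last exact: segment_compact.
exact: continuous_subspaceT.
Qed.

Lemma plane_compact_closed A : compact A -> closed A.
Proof. by apply: compact_closed; exact: norm_hausdorff. Qed.

Lemma arc_closed A p q : arc_between A p q -> closed A.
Proof. by move=> /arc_compact/plane_compact_closed. Qed.

Lemma arc_sym A p q : arc_between A p q -> arc_between A q p.
Proof.
move=> /arc_elim[f [cf fI [f0 f1] fA Af]].
apply: (@arc_intro (fun t => f (1 - t))).
- by apply: (cts_comp cf); cts.
- by move=> s t s01 t01 /fI; lra.
- by rewrite subr0.
- by rewrite subrr.
- by move=> t _; exact: fA.
- move=> z /Af[t t01 ->]; exists (1 - t); first lra.
  by rewrite subKr.
Qed.

Lemma plane_eq p q : p.1 = q.1 -> p.2 = q.2 -> p = q.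
Proof. by case: p q => [? ?] [? ?] /= -> ->. Qed.

(* Since [f 1 = g 0], the sum reduces to [f] on the first half of [0, 1] and
   to [g] on the second, which spares a case distinction for continuity. *)
Lemma arc_cat A B p q z : arc_between A p q -> arc_between B q z ->
  (forall y, A y -> B y -> y = q) -> arc_between (A `|` B) p z.
Proof.
move=> /arc_elim[f [cf fI [f0 f1] fA Af]] /arc_elim[g [cg gI [g0 g1] gB Bg]] AB.
pose a (t : R) := Num.min (2 * t) 1; pose b (t : R) := Num.max (2 * t - 1) 0.
pose h t := ((f (a t)).1 + (g (b t)).1 - q.1, (f (a t)).2 + (g (b t)).2 - q.2).
have h1 t : t <= 1 / 2 -> h t = f (2 * t).
  move=> t2; rewrite /h /a /b; rewrite (min_idPl _); last lra.
  by rewrite (max_idPr _); [rewrite g0; apply: plane_eq => /=; lra|lra].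
have h2 t : 1 / 2 <= t -> h t = g (2 * t - 1).
  move=> t2; rewrite /h /a /b; rewrite (min_idPr _); last lra.
  by rewrite (max_idPl _); [rewrite f1; apply: plane_eq => /=; lra|lra].
have cross s t : 0 <= s <= 1 -> 0 <= t <= 1 -> s <= 1 / 2 -> 1 / 2 <= t ->
    h s = h t -> s = t.
  move=> s01 t01 s2 t2; rewrite h1 // h2 // => e.
  have fq : f (2 * s) = q by apply: AB; [exact: fA|rewrite e; exact: gB].
  have : 2 * s = 1 by apply: fI; rewrite ?f1 //; lra.
  have : 2 * t - 1 = 0 by apply: gI; rewrite -?e ?fq ?g0 //; lra.
  lra.
apply: (@arc_intro h).
- have ca : continuous (fun t => f (a t)) by apply: (cts_comp cf); rewrite /a; cts.
  have cb : continuous (fun t => g (b t)) by apply: (cts_comp cg); rewrite /b; cts.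
  by rewrite /h; cts.
- move=> s t s01 t01; have [s2|s2] := leP s (1 / 2); have [t2|t2] := leP t (1 / 2).
  + by rewrite !h1 // => /fI; lra.
  + by apply: cross => //; lra.
  + by move=> e; symmetry; apply: cross => //; lra.
  + by rewrite !h2; [move=> /gI; lra|lra|lra].
- by rewrite h1 ?mulr0 //; lra.
- by rewrite h2 -?g1; [congr g; lra|lra].
- move=> t t01; have [t2|t2] := leP t (1 / 2); first by left; rewrite h1.
  by right; rewrite h2; [exact: gB|lra].
- move=> y [/Af|/Bg][t t01 ->].
    by exists (t / 2); [lra|rewrite h1; [congr f; lra|lra]].
  by exists ((t + 1) / 2); [lra|rewrite h2; [congr g; lra|lra]].
Qed.

Lemma arc_image A p q (X : set (R * R)) (h : R * R -> R * R) :
  arc_between A p q -> A `<=` X -> {within X, continuous h} ->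
  (forall x y, X x -> X y -> h x = h y -> x = y) ->
  arc_between (h @` A) (h p) (h q).
Proof.
move=> /arc_elim[f [cf fI [f0 f1] fA Af]] AX ch hI.
apply: (@arc_intro (fun t => h (f t))).
- by apply: (cts_within_comp ch cf) => s; exact/AX/fA.
- by move=> s t s01 t01 /hI fst; apply: fI => //; apply: fst; exact/AX/fA.
- by rewrite f0.
- by rewrite f1.
- by move=> t _; exists (f t).
- by move=> z [y /Af[t t01 ->] <-]; exists t.
Qed.

Lemma path_first_hit (f : R -> R * R) C : continuous f -> closed C -> C (f 1) ->
  exists t0, [/\ 0 <= t0 <= 1, C (f t0) &
    forall t, 0 <= t <= 1 -> C (f t) -> t0 <= t].
Proof.
move=> cf clC Cf1; pose S := [set t | 0 <= t <= 1 /\ C (f t)].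
have S1 : S 1 by split; [lra|].
have cS : compact S.
  have -> : S = `[0, 1] `&` (f @^-1` C).
    by apply/seteqP; split => t; rewrite /S /= in_itv.
  apply: compact_closedI; first exact: segment_compact.
  by apply: preimage_closed => // x _; exact: cf.
have [t0 /set_mem[t01 Ct0] t0min] : exists2 c, c \in S & forall t, t \in S -> c <= t.
  apply: (@compact_EVT_min _ _ (fun t => t)) => //; first by exists 1.
  by apply: continuous_subspaceT; cts.
by exists t0; split => // t t1 Ct; apply: t0min; rewrite inE.
Qed.

(** The piece up to the first hit; as [p] is outside [C], the hitting time is positive and the piece
    is a genuine arc. *)
Lemma arc_first_hit A C p q : arc_between A p q -> closed C -> C q -> ~ C p ->
  exists B a, [/\ arc_between B p a, B `<=` A, C a & forall z, B z -> C z -> z = a].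
Proof.
move=> /arc_elim[f [cf fI [f0 f1] fA Af]] clC; rewrite -f1 => Cq Cp.
have [t0 [t01 Ct0 t0min]] := path_first_hit cf clC Cq.
have t0gt : 0 < t0.
  rewrite lt_neqAle; apply/andP; split; last by lra.
  by apply/eqP => h; apply: Cp; rewrite -f0 h.
exists [set f t | t in [set t | 0 <= t <= t0]], (f t0); split => //.
- apply: (@arc_intro (fun t => f (t0 * t))).
  + by apply: (cts_comp cf); cts.
  + move=> s t s01 t1 /fI h; apply: (mulfI (lt0r_neq0 t0gt)); apply: h; nra.
  + by rewrite mulr0.
  + by rewrite mulr1.
  + by move=> t t1; exists (t0 * t) => //=; nra.
  + move=> z [t /= tt <-]; exists (t / t0); last by rewrite mulrC divfK ?gt_eqF.
    by rewrite divr_ge0 ?ler_pdivrMr //=; lra.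
- by move=> z [t _ <-].
- move=> z [t /= tt <-] /t0min h; congr f; have := h; lra.
Qed.

End Arcs.

(** * Segments, and arcs that are radial near an end *)

Section Segments.
Local Open Scope ring_scope.
Local Open Scope classical_set_scope.
Variable R : realType.
Implicit Types (A B C K : set (R * R)) (p q a b c x y z : R * R).

Definition line p q (t : R) : R * R :=
  (p.1 + t * (q.1 - p.1), p.2 + t * (q.2 - p.2)).

Definition seg p q : set (R * R) := [set line p q t | t in `[0, 1]].

Lemma line_cts p q : continuous (line p q).
Proof. by rewrite /line; cts. Qed.

Lemma line0 p q : line p q 0 = p.
Proof. by apply: plane_eq => /=; lra. Qed.

Lemma line1 p q : line p q 1 = q.
Proof. by apply: plane_eq => /=; lra. Qed.

Lemma segP p q z : seg p q z <-> exists2 t, 0 <= t <= 1 & z = line p q t.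
Proof.
split=> [[t /= +] <-|[t t01 ->]]; first by rewrite in_itv => t01; exists t.
by exists t; rewrite //= in_itv.
Qed.

Lemma seg_start p q : seg p q p.
Proof. by apply/segP; exists 0; rewrite ?line0 // lexx ler01. Qed.

Lemma seg_end p q : seg p q q.
Proof. by apply/segP; exists 1; rewrite ?line1 // lexx ler01. Qed.

Lemma line_inj p q : p <> q -> injective (line p q).
Proof.
move=> pq s t [/addrI h1 /addrI h2].
have [e1|/eqP n1] := eqVneq (q.1 - p.1) 0; last by apply: (mulIf _ h1); exact/eqP.
have [e2|/eqP n2] := eqVneq (q.2 - p.2) 0; last by apply: (mulIf _ h2); exact/eqP.
by exfalso; apply: pq; apply: plane_eq; lra.
Qed.

Lemma arc_seg p q : p <> q -> arc_between (seg p q) p q.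
Proof.
move=> pq; exists (line p q); split; rewrite ?line0 ?line1 //.
  exact: line_cts.
by move=> s t _ _ /(line_inj pq).
Qed.

Lemma seg_compact p q : compact (seg p q).
Proof.
apply: continuous_compact; last exact: segment_compact.
by apply: continuous_subspaceT; exact: line_cts.
Qed.

Lemma line_subE p q t : line p q t - p = t *: (q - p).
Proof. by apply: plane_eq => /=; rewrite addrC addKr. Qed.

Lemma seg_norm p q z : seg p q z -> `|z - p| <= `|q - p|.
Proof.
move=> /segP[t /andP[t0 t1] ->]; rewrite line_subE normrZ ger0_norm //.
by rewrite ler_piMl.
Qed.

Lemma seg_trans p q c z : seg p q c -> seg p c z -> seg p q z.
Proof.
move=> /segP[t t01 ->] /segP[s s01 ->]; apply/segP; exists (s * t); first nra.
by apply: plane_eq => /=; lra.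
Qed.

(** Taking norms in the two expressions of [z] shows that the parameters agree, and they cancel
    because [z <> p]. The norm of the plane is the maximum norm, so the discs used below are
    squares. *)
Lemma seg_radial p a b z : `|a - p| = `|b - p| -> seg p a z -> seg p b z ->
  z <> p -> a = b.
Proof.
move=> ab /segP[t /andP[t0 t1] ->] /segP[s /andP[s0 s1] e] zp.
have {}ab : `|a - p| != 0 -> t = s.
  move=> h; have := congr1 (fun x => `|x - p|) e; rewrite /= !line_subE !normrZ.
  by rewrite -ab !ger0_norm // => /(mulIf h).
have tn : t != 0 by apply/eqP => h; apply: zp; rewrite h line0.
have ap : `|a - p| != 0.
  rewrite normr_eq0 subr_eq0; apply/eqP => h; apply: zp; rewrite h.
  by apply: plane_eq => /=; lra.
have {ab ap} ts := ab ap; move: e; rewrite -ts => -[/addrI h1 /addrI h2].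
by apply: plane_eq; [move: (mulfI tn h1)|move: (mulfI tn h2)]; lra.
Qed.

Lemma norm_sub_cts p : continuous (fun z : R * R => `|z - p|).
Proof. by move=> z; apply: cvg_norm; apply: cvgB; [exact: cvg_id|exact: cvg_cst]. Qed.

Lemma closed_away K p : closed K -> ~ K p ->
  exists2 r : R, 0 < r & forall z, `|z - p| <= r -> ~ K z.
Proof.
move=> cK Kp; have : nbhs p (~` K).
  by apply: open_nbhs_nbhs; split; [exact: closed_openC|].
move=> /nbhs_ballP[e /= e0 eK]; exists (e / 2); first lra.
move=> z ze; apply: eK; rewrite -ball_normE /= distrC; lra.
Qed.

(** Follow the arc backwards from [q] to its first point [a] in the disc of radius [r] about [p],
    then go straight to [p]. The piece from [q] to [a] meets the disc in [a] only, so the new arc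
    meets it in the radius only. *)
Lemma arc_radial A p q (r : R) : arc_between A p q -> 0 < r < `|q - p| ->
  exists B a, [/\ arc_between B p q, `|a - p| = r, A a,
    forall z, `|z - p| <= r -> (B z <-> seg p a z) &
    forall z, B z -> ~ `|z - p| <= r -> A z].
Proof.
move=> Aa /andP[r0 rq].
have clC : closed [set z : R * R | `|z - p| <= r].
  apply: (@preimage_closed _ _ (fun z => `|z - p|) [set x : R | x <= r]) => //.
  by move=> z _; exact: norm_sub_cts.
have [||B [a [Ba BA /= ar Br]]] := arc_first_hit (arc_sym Aa) clC.
- by rewrite /= subrr normr0 ltW.
- by apply/negP; rewrite -ltNge.
have ar' : `|a - p| = r.
  have [f [cf fI [f0 f1] fB Bf]] := arc_elim Ba.
  (* The distance to [p] takes the value [r] on the piece, whose only point in the disc is [a]; so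
     [a] is on the boundary. *)
  have [|||c _ fc] := @IVT R (fun t => `|f t - p|) 0 1 r; first exact: ler01.
  - by apply: continuous_subspaceT; exact: cts_comp (@norm_sub_cts p) cf.
  - by rewrite f0 f1 ge_min ar orbT le_max (ltW rq).
  by rewrite -(Br (f c)) // fc.
have ap : p <> a.
  by move=> h; move: ar'; rewrite h subrr normr0; lra.
exists (seg p a `|` B), a; split => //.
- apply: arc_cat (arc_seg ap) (arc_sym Ba) _ => y /seg_norm.
  by rewrite ar' => yr By; apply: Br.
- exact/BA/(arc_end Ba).
- move=> z zr; split=> [[//|Bz]|]; last by left.
  by rewrite (Br z) //; exact: seg_end.
- by move=> z [/seg_norm|/BA//]; rewrite ar'.
Qed.

End Segments.

(** * Drawings with edges as point sets *)

Section PlaneDrawing.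
Local Open Scope ring_scope.
Local Open Scope classical_set_scope.
Variables (R : realType) (T : finType).
Implicit Types (G H : sgraph T) (pt : T -> R * R) (A : {set T} -> set (R * R)).

(** Conditions on interiors of arcs become conditions on common points: a point common to two edges
    is a vertex and, by [pd_pt], an end of both. *)
Record plane_drawing G pt A : Prop := PlaneDrawing {
  pd_inj : {in vset G &, injective pt};
  pd_arc : forall u v, [set u; v]%SET \in eset G ->
    arc_between (A [set u; v]%SET) (pt u) (pt v);
  pd_pt : forall f x, f \in eset G -> x \in vset G -> A f (pt x) -> x \in f;
  pd_cross : forall f g z, f \in eset G -> g \in eset G -> f != g ->
    A f z -> A g z -> exists2 x, x \in vset G & z = pt x }.

Lemma edge2P G f : f \in eset G -> exists u v, [/\ u != v, f = [set u; v]%SET,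
  u \in vset G & v \in vset G].
Proof.
move=> fG; have /eqP/cards2P[u [v [uv fE]]] := edge_card fG.
have := edge_sub fG; rewrite fE finset.subUset !finset.sub1set => /andP[uG vG].
by exists u, v.
Qed.

Lemma pd_edge_arc G pt A f : plane_drawing G pt A -> f \in eset G ->
  exists u v, arc_between (A f) (pt u) (pt v).
Proof.
move=> D fG; have [u [v [_ fE _ _]]] := edge2P fG.
by exists u, v; rewrite fE; apply: pd_arc D _ _ _; rewrite -fE.
Qed.

Lemma pd_closed G pt A f : plane_drawing G pt A -> f \in eset G -> closed (A f).
Proof. by move=> D /(pd_edge_arc D)[u [v]]; exact: arc_closed. Qed.

Lemma finite_union_closed (I : finType) (P : set I) (F : I -> set (R * R)) :
  (forall i, P i -> closed (F i)) -> closed (\bigcup_(i in P) F i).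
Proof. by apply: closed_bigcup; exact: finite_finset. Qed.

Lemma set1_plane_closed (p : R * R) : closed [set p].
Proof. by apply: plane_compact_closed; exact: compact_set1. Qed.

Lemma planar_plane_drawing G :
  planar R G -> exists pt A, plane_drawing G pt A.
Proof.
move=> [pt [arc D]]; exists pt, (fun f => [set arc f t | t in `[0, 1]]).
have i0 : (0 : R) \in `[0, 1]%R by rewrite in_itv /= lexx ler01.
have i1 : (1 : R) \in `[0, 1]%R by rewrite in_itv /= lexx ler01.
have arcV f t : f \in eset G -> 0 <= t <= 1 -> ~~ (0 < t < 1) ->
    exists2 x, x \in f & arc f t = pt x.
  move=> fG t01 t01'.
  have : [set arc f 0; arc f 1] (arc f t).
    have [->|tn0] := eqVneq t 0; first by left.
    have [->|tn1] := eqVneq t 1; first by right.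
    by exfalso; move: t01'; rewrite !lt_neqAle tn1 eq_sym tn0 t01.
  by rewrite (drawing_arc_ends D fG) => -[x /= xf <-]; exists x.
split.
- exact: drawing_pt_inj D.
- move=> u v fG; set f := [set u; v]%SET in fG *.
  have uv : u != v by have := edge_card fG; rewrite cards2; case: eqP.
  have [uG vG] : u \in vset G /\ v \in vset G.
    have := edge_sub fG; rewrite finset.subUset !finset.sub1set.
    by move=> /andP[].
  have puv : pt u <> pt v.
    by move=> /(drawing_pt_inj D uG vG) /eqP; apply/negP.
  pose h t := arc f (clamp t).
  have ch : continuous h.
    apply: (cts_within_comp (drawing_arc_cont D fG) (@clamp_cts R)) => s /=.
    by rewrite in_itv; exact: clamp_itv.
  have hI (s t : R) : 0 <= s <= 1 -> 0 <= t <= 1 -> h s = h t -> s = t.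
    move=> s01 t01; rewrite /h !clampK // => /(drawing_arc_inj D fG).
    by rewrite !in_itv; apply.
  have h0 : h 0 = arc f 0 by rewrite /h clampK // lexx ler01.
  have h1 : h 1 = arc f 1 by rewrite /h clampK // lexx ler01.
  have ha : arc_between [set arc f t | t in `[0, 1]] (arc f 0) (arc f 1).
    apply: (@arc_intro _ h) => //.
      by move=> t t01; exists t; rewrite ?/h ?clampK //= in_itv.
    move=> z [t /=]; rewrite in_itv => t01 <-; exists t => //.
    by rewrite /h clampK.
  have h01 := arc_neq ha.
  have ends := drawing_arc_ends D fG.
  have : [set arc f 0; arc f 1] (pt u).
    by rewrite ends; exists u => //=; rewrite !inE eqxx.
  have : [set arc f 0; arc f 1] (pt v).
    by rewrite ends; exists v => //=; rewrite !inE eqxx orbT.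
  (* The ends are known only as an unordered pair, so the parametrization may run from [v] to [u];
     the mixed cases contradict [puv]. *)
  move=> [] ev [] eu; rewrite ?eu ?ev //; try by case: puv; rewrite eu ev.
  exact: arc_sym.
- move=> f x fG xG [t /=]; rewrite in_itv => t01 e.
  have [t01'|/(arcV _ _ fG t01)[y yf]] := boolP (0 < t < 1).
    by case: (drawing_arc_pt D fG xG t01' e).
  rewrite e => /(drawing_pt_inj D xG) -> //.
  exact: (fintype.subsetP (edge_sub fG)).
- move=> f g z fG gG fg [s /=]; rewrite in_itv => s01 es [t /=].
  rewrite in_itv => t01 et.
  have [s01'|/(arcV _ _ fG s01)[y yf ey]] := boolP (0 < s < 1); last first.
    exists y; last by rewrite -es.
    exact: (fintype.subsetP (edge_sub fG)).
  have [t01'|/(arcV _ _ gG t01)[y yf ey]] := boolP (0 < t < 1); last first.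
    exists y; last by rewrite -et.
    exact: (fintype.subsetP (edge_sub gG)).
  by case: (drawing_arc_arc D fG gG fg s01' t01'); rewrite es et.
Qed.

Lemma plane_drawing_planar G pt A : plane_drawing G pt A -> planar R G.
Proof.
move=> D; have /choice[arc arcP] : forall f : {set T}, exists h : R -> R * R,
    f \in eset G -> exists u v, [/\ f = [set u; v]%SET, continuous h,
      forall s t : R, 0 <= s <= 1 -> 0 <= t <= 1 -> h s = h t -> s = t,
      h 0 = pt u /\ h 1 = pt v & forall t, A f (h t)].
  move=> f; case: (boolP (f \in eset G)) => fG; last by exists (fun=> 0).
  have [u [v [_ fE _ _]]] := edge2P fG.
  have /arc_elim[h [ch hI h01 hA _]] : arc_between (A f) (pt u) (pt v).
    by rewrite fE; apply: pd_arc D _ _ _; rewrite -fE.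
  by exists h => _; exists u, v.
have inner f x t : f \in eset G -> x \in vset G -> 0 < t < 1 -> arc f t <> pt x.
  move=> fG xG t01 e; have [u [v [fE _ hI [h0 h1] hA]]] := arcP _ fG.
  have : x \in f by apply: (pd_pt D fG xG); rewrite -e.
  rewrite fE !inE => /orP[] /eqP xE; move: e; rewrite xE -?h0 -?h1 => /hI h.
    by have : t = 0 by [apply: h; lra]; lra.
  by have : t = 1 by [apply: h; lra]; lra.
exists pt, arc; split => //.
- exact: pd_inj D.
- move=> f fG; have [u [v [_ ch _ _ _]]] := arcP _ fG.
  exact: continuous_subspaceT.
- move=> f fG s t; rewrite !in_itv => s01 t01.
  by have [u [v [_ _ hI _ _]]] := arcP _ fG; exact: hI.
- move=> f fG; have [u [v [fE _ _ [h0 h1] _]]] := arcP _ fG.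
  rewrite h0 h1; apply/seteqP; split => [z [->|->]|z [x /=]].
  + by exists u; rewrite //= fE !inE eqxx.
  + by exists v; rewrite //= fE !inE eqxx orbT.
  + by rewrite fE !inE => /orP[] /eqP -> <-; [left|right].
- move=> f g s t fG gG fg s01 t01 e.
  have [u [v [_ _ _ _ hA]]] := arcP _ fG; have [u' [v' [_ _ _ _ gA]]] := arcP _ gG.
  have [|x xG /(inner _ _ _ fG xG s01)//] := pd_cross D fG gG fg (hA s).
  by rewrite e.
Qed.

End PlaneDrawing.

(** * Passing to fewer edges, mapping a drawing, radial stars *)

Section DrawingSurgery.
Local Open Scope ring_scope.
Local Open Scope classical_set_scope.
Variables (R : realType) (T : finType).
Implicit Types (G H : sgraph T) (pt : T -> R * R) (A : {set T} -> set (R * R)).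

Lemma edge_mem G f x : f \in eset G -> x \in f -> x \in vset G.
Proof. by move=> /edge_sub/fintype.subsetP; apply. Qed.

Lemma finite_ub (I : finType) (F : I -> R) : exists M, forall i, F i <= M.
Proof.
exists (\sum_i `|F i|) => i; rewrite (bigD1 i) //=.
by rewrite (le_trans (ler_norm _)) // lerDl sumr_ge0.
Qed.

(* Vertices of H missing from G go far to the right of the drawing of G. *)
Lemma planar_eset_sub G H : eset H \subset eset G -> planar R G -> planar R H.
Proof.
move=> /fintype.subsetP HG /planar_plane_drawing[pt [A D]].
have /choice[m mP] : forall f, exists m : R,
    f \in eset G -> forall z, A f z -> z.1 <= m.
  move=> f; case: (boolP (f \in eset G)) => fG; last by exists 0.
  have [u [v /arc_compact/compact_bounded[m [_ mP]]]] := pd_edge_arc D fG.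
  exists (m + 1) => _ z Az; apply: le_trans (ler_norm _) _.
  apply: le_trans (mP (m + 1) _ z Az); first by rewrite prod_normE le_max lexx.
  by rewrite ltrDl.
have [M1 M1P] := finite_ub m; have [M2 M2P] := finite_ub (fun x => (pt x).1).
pose M := Num.max M1 M2.
have {M1P} AM f z : f \in eset G -> A f z -> z.1 <= M.
  by move=> fG /(mP f fG) zm; rewrite le_max (le_trans zm).
have {M2P} pM x : (pt x).1 <= M by rewrite le_max M2P orbT.
pose pt' x : R * R := if x \in vset G then pt x else (M + 1 + (enum_rank x)%:R, 0).
have pE x : x \in vset G -> pt' x = pt x by rewrite /pt' => ->.
have far x : x \notin vset G -> M < (pt' x).1.
  by move=> /negPf xG; rewrite /pt' xG /=; have := ler0n R (enum_rank x); lra.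
apply: (@plane_drawing_planar _ _ _ pt' A); split.
- move=> x y _ _.
  case: (boolP (x \in vset G)) (far x) => xG fx;
    case: (boolP (y \in vset G)) (far y) => yG fy e.
  + by apply: (pd_inj D) => //; rewrite -!pE.
  + by have := fy isT; rewrite -e pE // ltNge pM.
  + by have := fx isT; rewrite e pE // ltNge pM.
  + move: e; rewrite /pt' (negPf xG) (negPf yG) => -[/addrI/eqP].
    by rewrite eqr_nat => /eqP/val_inj/enum_rank_inj.
- move=> u v uvH; have uvG := HG _ uvH.
  by rewrite !pE ?(edge_mem uvG) ?inE ?eqxx ?orbT //; exact: pd_arc D _ _ _.
- move=> f x fH xH; have fG := HG _ fH.
  case: (boolP (x \in vset G)) => xG; first by rewrite pE //; exact: pd_pt D _ _ _ _.
  by move=> /(AM _ _ fG); rewrite leNgt far.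
- move=> f g z fH gH fg fz gz.
  have [x xG e] := pd_cross D (HG _ fH) (HG _ gH) fg fz gz.
  exists x; last by rewrite pE.
  by apply: (edge_mem fH); apply: (pd_pt D) => //; [exact: HG|rewrite -e].
Qed.

Lemma set2_eqr (x y z : T) : [set x; y]%SET = [set x; z]%SET -> x != y -> y = z.
Proof.
move=> e xy; have : y \in [set x; z]%SET by rewrite -e !inE eqxx orbT.
by rewrite !inE eq_sym (negPf xy) /= => /eqP.
Qed.

(** The map need only be injective on a set containing the vertices and the edges other than [e],
    because [e] receives a new arc [Q] instead of its image. Redrawing [e], collapsing a part of it
    and cutting the plane open along it are all instances. *)
Lemma pd_map G pt A e u v (X : set (R * R)) (h : R * R -> R * R) Q :
  plane_drawing G pt A -> e \in eset G -> e = [set u; v]%SET ->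
  {within X, continuous h} -> (forall x y, X x -> X y -> h x = h y -> x = y) ->
  (forall x, x \in vset G -> X (pt x)) ->
  (forall f, f \in eset G -> f != e -> A f `<=` X) ->
  arc_between Q (h (pt u)) (h (pt v)) ->
  (forall f z, f \in eset G -> f != e -> A f z -> Q (h z) ->
     exists2 x, x \in vset G & h z = h (pt x)) ->
  (forall x, x \in vset G -> Q (h (pt x)) -> x \in e) ->
  plane_drawing G (fun x => h (pt x)) (fun f => if f == e then Q else h @` A f).
Proof.
move=> D eG eE ch hI Xpt XA Qa QA Qpt; split.
- by move=> x y xG yG /hI /(pd_inj D xG yG) k; apply: k; exact: Xpt.
- move=> u' v' fG; have uv' : u' != v'.
    by have := edge_card fG; rewrite cards2; case: eqP.
  case: ifPn => [/eqP fe|fe]; last first.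
    by apply: arc_image (pd_arc D fG) _ ch hI; exact: XA.
  have : u' \in e by rewrite -fe !inE eqxx.
  rewrite eE !inE => /orP[] /eqP uE; move: fe; rewrite eE uE => fe.
    by rewrite (set2_eqr fe) // -uE.
  rewrite [in RHS]finset.setUC in fe.
  have -> : v' = u by apply: set2_eqr fe _; rewrite -uE.
  exact: arc_sym.
- move=> f x fG xG; case: ifPn => [/eqP -> /(Qpt _ xG)//|fe [z zA]].
  move=> /hI zE; apply: (pd_pt D fG xG); rewrite -zE //; first exact: XA zA.
  exact: Xpt.
- move=> f g z fG gG fg; case: ifPn => [/eqP fe|fe]; case: ifPn => [/eqP ge|ge].
  + by rewrite fe ge eqxx in fg.
  + by move=> Qz [w wA wE]; rewrite -wE in Qz *; exact: QA gG ge wA Qz.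
  + by move=> [w wA wE] Qz; rewrite -wE in Qz *; exact: QA fG fe wA Qz.
  + move=> [w wA <-] [w' wA' /hI e'].
    have ww : w' = w by apply: e'; [exact: XA wA'|exact: XA wA].
    rewrite ww in wA'; have [x xG ->] := pd_cross D fG gG fg wA wA'.
    by exists x.
Qed.

(** The disc misses the other vertices and the edges not ending at [x]; the edges at [x] are then
    made radial in it. Two radii sharing a point besides the centre have the same end on the
    boundary, a point of both old arcs, which would be another vertex in the disc. The bound [d]
    lets a second disc be kept apart from a first one. *)
Lemma pd_star G pt A x (d : R) : plane_drawing G pt A -> x \in vset G -> 0 < d ->
  exists r B, [/\ 0 < r < d, plane_drawing G pt B,
    forall y, y \in vset G -> y != x -> ~ `|pt y - pt x| <= r,
    forall f z, f \in eset G -> B f z -> A f z \/ `|z - pt x| <= r &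
    forall f, f \in eset G -> x \in f -> exists a,
      forall z, `|z - pt x| <= r -> (B f z <-> seg (pt x) a z)].
Proof.
move=> D xG d0; set p := pt x.
pose K := (\bigcup_(f in [set f | f \in eset G /\ x \notin f]) A f) `|`
          (\bigcup_(y in [set y | y \in vset G /\ y != x]) [set pt y]).
have [||r0 r00 r0K] := @closed_away _ K p.
- apply: closedU; apply: finite_union_closed.
    by move=> f [fG _]; exact: pd_closed D fG.
  by move=> y _; exact: set1_plane_closed.
- move=> [[f [fG xf] /(pd_pt D fG xG)]|[y [yG yx] /(pd_inj D xG yG) yE]].
    by apply/negP.
  by rewrite yE eqxx in yx.
pose r := Num.min r0 (d / 2).
have rpos : 0 < r by rewrite lt_min r00; lra.
have rd : r < d by rewrite gt_min; apply/orP; right; lra.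
have rK z : `|z - p| <= r -> ~ K z by rewrite le_min => /andP[/r0K].
have Vr y : y \in vset G -> y != x -> ~ `|pt y - p| <= r.
  by move=> yG yx /rK; apply; right; exists y.
have /choice[B BP] : forall f, exists Ba : set (R * R) * (R * R),
    f \in eset G -> x \in f ->
    [/\ forall y, f = [set x; y]%SET -> arc_between Ba.1 p (pt y),
      `|Ba.2 - p| = r, A f Ba.2,
      forall z, `|z - p| <= r -> (Ba.1 z <-> seg p Ba.2 z) &
      forall z, Ba.1 z -> ~ `|z - p| <= r -> A f z].
  move=> f; case: (boolP (f \in eset G)) => fG; last by exists (set0, 0).
  case: (boolP (x \in f)) => xf; last by exists (set0, 0).
  have [y [xy fE yG]] : exists y, [/\ x != y, f = [set x; y]%SET & y \in vset G].
    have [u [v [uv fE uG vG]]] := edge2P fG.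
    move: xf; rewrite fE !inE => /orP[] /eqP ->; first by exists v.
    by exists u; rewrite eq_sym finset.setUC.
  have Aa : arc_between (A f) p (pt y).
    by rewrite fE; apply: pd_arc D _ _ _; rewrite -fE.
  have [|C [a [Ca ar Af Cr CA]]] := arc_radial (r := r) Aa.
    by rewrite rpos ltNge; apply/negP; apply: Vr; rewrite // eq_sym.
  exists (C, a) => _ _; split => // y'; rewrite fE => /set2_eqr yE.
  by rewrite -yE.
pose A' (f : {set T}) := if x \in f then (B f).1 else A f.
have A'A f z : f \in eset G -> A' f z -> ~ `|z - p| <= r -> A f z.
  rewrite /A' => fG; case: ifPn => // xf; have [_ _ _ _ h] := BP f fG xf.
  exact: h.
have A'x f z : f \in eset G -> x \notin f -> A' f z -> ~ `|z - p| <= r.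
  by rewrite /A' => fG xf; rewrite (negPf xf) => Az /rK; apply; left; exists f.
exists r, A'; split => //; first by rewrite rpos.
- split; first exact: pd_inj D.
  + move=> u v fG; rewrite /A'; case: ifPn => [xf|_]; last exact: pd_arc D _ _ _.
    have [h _ _ _ _] := BP _ fG xf; move: xf; rewrite !inE => /orP[] /eqP xE.
      by have := h v; rewrite /p xE; apply.
    by apply: arc_sym; have := h u; rewrite /p xE; apply; rewrite finset.setUC.
  + move=> f y fG yG fy.
    have [yE|yx] := eqVneq y x.
      rewrite yE; have [//|xf] := boolP (x \in f); case: (A'x _ _ fG xf fy).
      by rewrite yE subrr normr0 ltW.
    by apply: (pd_pt D fG yG); apply: A'A fG fy _; exact: Vr.
  + move=> f g z fG gG fg fz gz.
    have [zr|/negP zr] := boolP (`|z - p| <= r); last first.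
      by apply: (pd_cross D fG gG fg); exact: A'A.
    have [xf|xf] := boolP (x \in f); last by case: (A'x _ _ fG xf fz).
    have [xg|xg] := boolP (x \in g); last by case: (A'x _ _ gG xg gz).
    move: fz gz; rewrite /A' xf xg.
    have [_ fr fA fs _] := BP _ fG xf; have [_ gr gA gs _] := BP _ gG xg.
    move=> /(fs _ zr) fz /(gs _ zr) gz.
    have [->|/eqP zp] := eqVneq z p; first by exists x.
    have ab : (B f).2 = (B g).2 by apply: seg_radial fz gz zp; rewrite fr gr.
    rewrite -ab in gA; have [y yG yE] := pd_cross D fG gG fg fA gA.
    have [yx|yx] := eqVneq y x; last by case: (Vr _ yG yx); rewrite -yE fr.
    by move: fr; rewrite yE yx subrr normr0; lra.
- move=> f z fG fz; have [zr|/negP zr] := boolP (`|z - p| <= r); first by right.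
  by left; exact: A'A.
- by move=> f fG xf; exists (B f).2; rewrite /A' xf; case: (BP f fG xf).
Qed.

End DrawingSurgery.

(** * Simple polygonal lines *)

Section Polygons.
Local Open Scope ring_scope.
Local Open Scope classical_set_scope.
Variable R : realType.
Implicit Types (p q a b c x y z : R * R) (s : seq (R * R)).

Lemma seg_sym p q z : seg p q z -> seg q p z.
Proof.
move=> /segP[t t01 ->]; apply/segP; exists (1 - t); first lra.
by apply: plane_eq => /=; lra.
Qed.

Fixpoint polyline p s : set (R * R) :=
  if s is q :: s' then seg p q `|` polyline q s' else [set p].

(** A single point counts as simple, so [p <> last p s] is asked separately when an arc is
    wanted. *)
Fixpoint simple_polyline p s : Prop :=
  if s is q :: s' then
    [/\ p <> q, forall z, seg p q z -> polyline q s' z -> z = q & simple_polyline q s']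
  else True.

Lemma polyline_start p s : polyline p s p.
Proof. by case: s => [|q s] //=; left; exact: seg_start. Qed.

Lemma polyline_last p s : polyline p s (last p s).
Proof. by elim: s p => [|q s IH] p //=; right; exact: IH. Qed.

Lemma polyline_compact p s : compact (polyline p s).
Proof.
elim: s p => [|q s IH] p /=; first exact: compact_set1.
by apply: compactU; [exact: seg_compact|exact: IH].
Qed.

Lemma polyline_rcons p s q :
  polyline p (rcons s q) `<=` polyline p s `|` seg (last p s) q.
Proof.
elim: s p => [|c s IH] p /=; first by move=> z [|->]; right => //; exact: seg_end.
by move=> z [zs|/IH[zs|zs]]; [left; left|left; right|right].
Qed.

Lemma simple_polyline_arc p s : simple_polyline p s -> p <> last p s ->
  arc_between (polyline p s) p (last p s).
Proof.
elim: s p => [|q s IH] p //= [pq disj sq] _.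
case: s IH disj sq => [|c s] IH disj sq /=.
  have -> : seg p q `|` [set q] = seg p q.
    by apply/seteqP; split => z; [move=> [//|->]; exact: seg_end|left].
  exact: arc_seg.
apply: arc_cat (arc_seg pq) _ _; last exact: disj.
apply: IH => //=; move: sq => /= [qc h _] e.
by apply: qc; apply: h; [exact: seg_start|rewrite {1}e; exact: polyline_last].
Qed.

Lemma simple_polyline_from p s z : simple_polyline p s -> polyline p s z ->
  exists s', [/\ last z s' = last p s, simple_polyline z s' &
    polyline z s' `<=` polyline p s].
Proof.
elim: s p => [|q s IH] p /=; first by move=> _ ->; exists [::]; split.
move=> [pq disj sq] [zs|/(IH _ sq)[s' [h1 h2 h3]]]; last first.
  by exists s'; split => // y /h3; right.
have [zq|/eqP zq] := eqVneq z q; first by exists s; rewrite zq; split => // y; right.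
have zsub : seg z q `<=` seg p q.
  by move=> y /seg_sym yz; apply: seg_sym; apply: seg_trans yz; exact: seg_sym.
exists (q :: s); split => //=; first by split => // y /zsub; exact: disj.
by move=> y [/zsub|]; [left|right].
Qed.

(** The tail is made simple first; the new first segment is followed only up to its first point on
    the tail, and the tail takes over from there. *)
Lemma polyline_loop_erase p s : exists s',
  [/\ last p s' = last p s, simple_polyline p s' & polyline p s' `<=` polyline p s].
Proof.
elim: s p => [|q s IH] p; first by exists [::]; split.
have [s1 [l1 sp1 sub1]] := IH q => /=.
have cl : closed (polyline q s1).
  by apply: plane_compact_closed; exact: polyline_compact.
have [ps|ps] := pselect (polyline q s1 p).
  have [s2 [l2 sp2 sub2]] := simple_polyline_from sp1 ps.
  by exists s2; split; rewrite ?l2 // => z /sub2/sub1; right.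
have [|t0 [t01 Ct0 t0min]] := path_first_hit (@line_cts _ p q) cl.
  by rewrite line1; exact: polyline_start.
set a := line p q t0 in Ct0.
have pa : p <> a by move=> e; apply: ps; rewrite e.
have t0p : 0 < t0.
  rewrite lt_neqAle; apply/andP; split; last by lra.
  by apply/eqP => h; apply: pa; rewrite /a -h line0.
have [s2 [l2 sp2 sub2]] := simple_polyline_from sp1 Ct0.
have aq : seg p q a by apply/segP; exists t0.
exists (a :: s2); split; rewrite /= ?l2 //; last first.
  by move=> z [zs|/sub2/sub1]; [left; exact: seg_trans zs|right].
split => // z /segP[t t1 ->] /sub2.
(* In terms of [line p q] the parameter is [t * t0]; minimality of [t0] forces [t = 1]. *)
have -> : line p a t = line p q (t * t0) by apply: plane_eq => /=; lra.
move=> /t0min h; have {}h : t0 <= t * t0 by apply: h; nra.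
rewrite /a; congr line; nra.
Qed.

(** The points of [U] joined to [b] by a polyline in [U] form an open set with open complement in
    [U]; a connected set containing [b] cannot be split by it. *)
Lemma polygon_connect (U S : set (R * R)) a b : open U -> connected S ->
  S `<=` U -> S a -> S b -> exists2 s, last a s = b & polyline a s `<=` U.
Proof.
move=> oU cS SU Sa Sb.
pose Z := [set z | exists2 s, last z s = b & polyline z s `<=` U].
have ext z z' (r : R) : (forall y, `|y - z| <= r -> U y) -> `|z' - z| <= r ->
    (Z z -> Z z') /\ (Z z' -> Z z).
  move=> zU z'r; have segU y : seg z z' y -> U y.
    by move=> /seg_norm yz; apply: zU; exact: le_trans yz z'r.
  split => -[s ls sU].
    by exists (z :: s) => //= y [/seg_sym/segU|/sU].
  by exists (z' :: s) => //= y [/segU|/sU].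
have nbU z : U z -> exists2 r : R, 0 < r & forall y, `|y - z| <= r -> U y.
  move=> Uz; have [||r r0 rU] := @closed_away _ (~` U) z.
  - exact: open_closedC.
  - by apply.
  by exists r => // y /rU; rewrite /= => /contrapT.
have nbhsr z (r : R) (P : set (R * R)) : 0 < r ->
    (forall y, `|y - z| <= r -> P y) -> nbhs z P.
  move=> r0 rP; apply/nbhs_ballP; exists r => // y.
  by rewrite -ball_normE /= distrC => yr; apply: rP; exact: ltW.
have ZU z : Z z -> U z by move=> [s _ sU]; apply: sU; exact: polyline_start.
have oZ : open Z.
  rewrite openE => z Zz; have [r r0 rU] := nbU _ (ZU _ Zz).
  by apply: (nbhsr z r) => // y yr; apply: (ext z y r rU yr).1.
have oUZ : open (U `\` Z).
  rewrite openE => z [Uz Zz]; have [r r0 rU] := nbU _ Uz.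
  apply: (nbhsr z r) => // y yr; split; first exact: rU.
  by move=> /(ext z y r rU yr).2.
suff SZ : S `&` Z = S by move: Sa; rewrite -SZ => -[].
apply: cS.
- by exists b; split => //; exists [::] => //= y ->; exact: SU.
- by exists Z.
- exists (~` (U `\` Z)); first exact: open_closedC.
  apply/seteqP; split => z [Sz h]; split => //; first by case.
  by apply: contrapT => nZ; apply: h; split => //; exact: SU.
Qed.

End Polygons.

(** * Redrawing one edge as a polygonal line *)

Section Polygonal.
Local Open Scope ring_scope.
Local Open Scope classical_set_scope.
Variables (R : realType) (T : finType).
Implicit Types (G H : sgraph T) (pt : T -> R * R) (A : {set T} -> set (R * R)).

Lemma path_near (f : R -> R * R) (r : R) : continuous f -> 0 < r ->
  exists2 s, 0 < s < 1 & `|f s - f 0| <= r.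
Proof.
move=> cf r0; have /cvgrPdist_le/(_ r r0) := cf 0.
move=> /nbhs_ballP[d /= d0 dP]; exists (Num.min (d / 2) (1 / 2)).
  by rewrite lt_min gt_min; apply/andP; split; [|apply/orP; right]; lra.
rewrite distrC; apply: dP; rewrite -ball_normE /= sub0r normrN ger0_norm.
  by rewrite gt_min; apply/orP; left; lra.
by rewrite le_min; lra.
Qed.

Lemma pd_polygon G pt A e u v : plane_drawing G pt A -> e \in eset G ->
  e = [set u; v]%SET -> exists B s,
  [/\ plane_drawing G pt B, simple_polyline (pt u) s, last (pt u) s = pt v &
      B e = polyline (pt u) s].
Proof.
move=> D eG eE.
have ue : u \in e by rewrite eE !inE eqxx.
have ve : v \in e by rewrite eE !inE eqxx orbT.
have uG := edge_mem eG ue; have vG := edge_mem eG ve.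
have uv : v != u by have := edge_card eG; rewrite eE cards2 eq_sym; case: eqP.
have [r1 [A1 [/andP[r10 _] D1 V1 _ S1]]] := pd_star D uG (@ltr01 R).
(* The second radius is smaller than the distance of the two ends minus the first radius, so the
   discs are disjoint. *)
have [|r2 [A2 [/andP[r20 r2d] D2 V2 A21 S2]]] :=
    @pd_star _ _ _ _ _ _ (`|pt v - pt u| - r1) D1 vG.
  by rewrite subr_gt0 ltNge; apply/negP; exact: V1.
have far z : `|z - pt u| <= r1 -> ~ `|z - pt v| <= r2.
  move=> zu zv; have := ler_distD z (pt v) (pt u).
  by rewrite (distrC (pt v) z); lra.
have /arc_elim[f [cf fI [f0 f1] fA _]] : arc_between (A2 e) (pt u) (pt v).
  by rewrite eE; apply: pd_arc D2 _ _ _; rewrite -eE.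
(* The obstacles: the other edges and all vertices. The new edge may meet them at its two ends
   only. *)
pose K := (\bigcup_(g in [set g | g \in eset G /\ g != e]) A2 g) `|`
          (\bigcup_(y in [set y | y \in vset G]) [set pt y]).
have clK : closed K.
  apply: closedU; apply: finite_union_closed.
    by move=> g [gG _]; exact: pd_closed D2 gG.
  by move=> y _; exact: set1_plane_closed.
have KV z w : w \in vset G -> ~ (exists2 x, x \in vset G & z = pt x /\ x <> w) ->
    (forall g, g \in eset G -> g != e -> A2 g z ->
       exists2 x, x \in vset G & z = pt x) ->
    z = pt w \/ (~` K) z.
  move=> wG zw zg; have [Kz|] := pselect (K z); last by right.
  have [x xG zx] : exists2 x, x \in vset G & z = pt x.
    by case: Kz => [[g [gG ge] gz]|[x xG ->]]; [exact: zg gG ge gz|exists x].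
  have [xw|/eqP xw] := eqVneq x w; first by left; rewrite zx xw.
  by case: zw; exists x.
have [s s01 su] := path_near cf r10; rewrite f0 in su.
have cf' : continuous (fun t : R => f (1 - t)) by apply: (cts_comp cf); cts.
have [t' t'01] := path_near cf' r20; rewrite subr0 f1.
set t := 1 - t' => tv; have t01 : 0 < t < 1 by rewrite /t; lra.
have [a1 a1P] := S1 _ eG ue; have [a2 a2P] := S2 _ eG ve.
have c1 : seg (pt u) a1 (f s).
  by apply/(a1P _ su); have [//|/(far _ su)] := A21 _ _ eG (fA s).
have d2 : seg (pt v) a2 (f t) by apply/(a2P _ tv).
(* The initial segment lies on [A1 e], and the second star adds points only near [v]; so a crossing
   with [A2 g] here is one with [A1 g], and [D1] applies. *)
have segu z : seg (pt u) (f s) z -> z = pt u \/ (~` K) z.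
  move=> zs; have zr := le_trans (seg_norm zs) su; apply: KV => //.
    move=> [x xG [zx xu]]; apply: (V1 _ xG); first exact/eqP.
    by rewrite -zx.
  move=> g gG ge gz; apply: (pd_cross D1 gG eG ge).
    by have [//|/(far _ zr)] := A21 _ _ gG gz.
  by apply/(a1P _ zr); exact: seg_trans c1 zs.
have segv z : seg (pt v) (f t) z -> z = pt v \/ (~` K) z.
  move=> zs; have zr := le_trans (seg_norm zs) tv; apply: KV => //.
    move=> [x xG [zx xu]]; apply: (V2 _ xG); first exact/eqP.
    by rewrite -zx.
  move=> g gG ge gz; apply: (pd_cross D2 gG eG ge gz).
  by apply/(a2P _ zr); exact: seg_trans d2 zs.
have fK (x : R) : 0 < x < 1 -> (~` K) (f x).
  move=> x01 Kfx; have [y yG fy] : exists2 y, y \in vset G & f x = pt y.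
    case: Kfx => [[g [gG ge] gz]|[y yG ->]]; last by exists y.
    by apply: (pd_cross D2 gG eG ge gz); exact: fA.
  have : y \in e by apply: (pd_pt D2 eG yG); rewrite -fy.
  rewrite eE !inE => /orP[] /eqP yE; move: fy; rewrite yE -?f0 -?f1 => /fI h.
    by have : x = 0 by [apply: h; lra]; lra.
  by have : x = 1 by [apply: h; lra]; lra.
have [q lq qK] : exists2 q, last (f s) q = f t & polyline (f s) q `<=` ~` K.
  (* Which of the parameters [s] and [t] is larger is unknown, hence the minimum and maximum. *)
  apply: (@polygon_connect _ _ (f @` `[Num.min s t, Num.max s t])).
  - exact: closed_openC.
  - apply: connected_continuous_connected; first exact: segment_connected.
    exact: continuous_subspaceT.
  - move=> z [x /=]; rewrite in_itv /= => /andP[x1 x2] <-; apply: fK.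
    by move: x1 x2; rewrite ge_min le_max; lra.
  - by exists s; rewrite //= in_itv /= ge_min le_max lexx.
  - by exists t; rewrite //= in_itv /= ge_min le_max lexx !orbT.
(* The end segments and the middle path may cross each other, so loops are erased on the whole. *)
have [q' [lq' sq' subq']] := polyline_loop_erase (pt u) (f s :: rcons q (pt v)).
rewrite /= last_rcons in lq'.
have q'K z : polyline (pt u) q' z -> [\/ z = pt u, z = pt v | (~` K) z].
  move=> /subq' /= [/segu[->|]|/polyline_rcons[/qK|]].
  - by constructor 1.
  - by constructor 3.
  - by constructor 3.
  - by rewrite lq => /seg_sym/segv[->|]; [constructor 2|constructor 3].
have puv : pt u <> pt v by move=> /(pd_inj D uG vG) /eqP; rewrite eq_sym; apply/negP.
exists (fun g => if g == e then polyline (pt u) q' else id @` A2 g), q'.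
rewrite eqxx; split => //.
apply: (@pd_map _ _ G pt A2 e u v setT id _ D2 eG eE) => //.
- by apply: continuous_subspaceT; exact: cts_id.
- by rewrite -lq'; apply: simple_polyline_arc => //; rewrite lq'.
- move=> g z gG ge gz /q'K[->|->|]; [by exists u|by exists v|].
  by case; left; exists g.
- move=> x xG /q'K[|/(pd_inj D xG vG) ->//|[]].
    by move=> /(pd_inj D xG uG) ->.
  by right; exists x.
Qed.

End Polygonal.

(** * A plane map collapsing one segment of a polygon *)

Section Collapse.
Local Open Scope ring_scope.
Local Open Scope classical_set_scope.
Variable R : realType.
Implicit Types (p q a b c x y z : R * R) (s : seq (R * R)).

(** Cramer's rule, [d] and [w] being a basis. *)
Lemma affine_coords (p d w : R * R) : d.1 * w.2 - d.2 * w.1 != 0 ->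
  exists X Y : R * R -> R, [/\ continuous X, continuous Y,
    forall z, z = (p.1 + X z * d.1 + Y z * w.1, p.2 + X z * d.2 + Y z * w.2) &
    forall x y : R, X (p.1 + x * d.1 + y * w.1, p.2 + x * d.2 + y * w.2) = x /\
      Y (p.1 + x * d.1 + y * w.1, p.2 + x * d.2 + y * w.2) = y].
Proof.
move=> D0.
exists (fun z => ((z.1 - p.1) * w.2 - (z.2 - p.2) * w.1) * (d.1 * w.2 - d.2 * w.1)^-1).
exists (fun z => ((z.2 - p.2) * d.1 - (z.1 - p.1) * d.2) * (d.1 * w.2 - d.2 * w.1)^-1).
split; [by cts|by cts| |].
- by move=> z; apply: plane_eq => /=; field.
- by move=> x y; split => /=; field.
Qed.

(** A vector parallel to ([d1], [d2]) equals its orthogonal projection onto it. *)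
Lemma parallel_coord (a b d1 d2 : R) : d1 * d1 + d2 * d2 != 0 ->
  d1 * b - d2 * a = 0 ->
  a = (a * d1 + b * d2) / (d1 * d1 + d2 * d2) * d1 /\
  b = (a * d1 + b * d2) / (d1 * d1 + d2 * d2) * d2.
Proof.
move=> n0 e; split; apply: (mulIf n0); rewrite mulrAC divfK //; apply: subr0_eq.
  by transitivity (- d2 * (d1 * b - d2 * a)); [ring|rewrite e mulr0].
by transitivity (d1 * (d1 * b - d2 * a)); [ring|rewrite e mulr0].
Qed.

(* In these coordinates [p0] is (-1, 0), [p1] is the origin and the segment
   from [p1] to [p2] stays in the half-plane where the first coordinate is
   nonnegative. *)
Lemma adapted_coords p0 p1 p2 : p0 <> p1 ->
  (forall z, seg p0 p1 z -> seg p1 p2 z -> z = p1) ->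
  exists X Y : R * R -> R, [/\ continuous X /\ continuous Y,
    forall z z', X z = X z' -> Y z = Y z' -> z = z',
    forall z (m : R), let z' := (z.1 + m * (p1.1 - p0.1), z.2 + m * (p1.2 - p0.2)) in
      X z' = X z + m /\ Y z' = Y z,
    X p1 = 0 /\ Y p1 = 0 & forall z, seg p1 p2 z -> 0 <= X z].
Proof.
move=> p01 disj.
have [d dE] : exists d : R * R, d = (p1.1 - p0.1, p1.2 - p0.2) by eexists.
suff [w [w0 wP]] : exists w, d.1 * w.2 - d.2 * w.1 != 0 /\
    exists x2 y2 : R, 0 <= x2 /\
      p2 = (p1.1 + x2 * d.1 + y2 * w.1, p1.2 + x2 * d.2 + y2 * w.2).
  have [X [Y [cX cY XYE XYP]]] := affine_coords p1 w0.
  exists X, Y; split => //.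
  - by move=> z z' eX eY; rewrite (XYE z) (XYE z') eX eY.
  - move=> z m z'.
    have -> : z' = (p1.1 + (X z + m) * d.1 + Y z * w.1,
                    p1.2 + (X z + m) * d.2 + Y z * w.2).
      rewrite /z' {1 2}(XYE z); apply: plane_eq => /=; rewrite dE /=; ring.
    by have [-> ->] := XYP (X z + m) (Y z).
  - have p1E : p1 = (p1.1 + 0 * d.1 + 0 * w.1, p1.2 + 0 * d.2 + 0 * w.2).
      by apply: plane_eq => /=; ring.
    by have := XYP 0 0; rewrite -p1E.
  - move=> z /segP[t /andP[t0 _] ->]; have [x2 [y2 [x20 p2E]]] := wP.
    have -> : line p1 p2 t = (p1.1 + (t * x2) * d.1 + (t * y2) * w.1,
                              p1.2 + (t * x2) * d.2 + (t * y2) * w.2).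
      by rewrite p2E; apply: plane_eq => /=; ring.
    by have [-> _] := XYP (t * x2) (t * y2); exact: mulr_ge0.
(* If [p2 - p1] is not parallel to [d], it serves as second axis and [p2] has coordinates (0, 1).
   Otherwise the second axis is orthogonal to [d] and [p2] is on the first one, at abscissa [x2]. *)
have [D0|D0] := eqVneq (d.1 * (p2.2 - p1.2) - d.2 * (p2.1 - p1.1)) 0; last first.
  exists (p2.1 - p1.1, p2.2 - p1.2); split => //; exists 0, 1; split => //.
  by apply: plane_eq => /=; ring.
have dpos : 0 < d.1 * d.1 + d.2 * d.2.
  rewrite lt_neqAle eq_sym; apply/andP; split; last first.
    by apply: addr_ge0; rewrite -expr2 sqr_ge0.
  rewrite paddr_eq0 -?expr2 ?sqr_ge0 // !sqrf_eq0.
  apply/negP => /andP[/eqP d1 /eqP d2]; apply: p01.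
  by apply: plane_eq; [move: d1|move: d2]; rewrite dE /=; lra.
have dn : d.1 * d.1 + d.2 * d.2 != 0 by rewrite gt_eqF.
exists (- d.2, d.1); split => /=; first by rewrite mulrN opprK.
pose x2 := ((p2.1 - p1.1) * d.1 + (p2.2 - p1.2) * d.2) / (d.1 * d.1 + d.2 * d.2).
have p2E : p2 = (p1.1 + x2 * d.1, p1.2 + x2 * d.2).
  have [e1 e2] := parallel_coord dn D0.
  by apply: plane_eq => /=; rewrite -/x2 in e1 e2 *; lra.
exists x2, 0; split; last by rewrite {1}p2E !mul0r !addr0.
(* For negative [x2] the second segment would fold back over the first: the point at abscissa [- m]
   is on both and differs from [p1]. *)
rewrite leNgt; apply/negP => x2n.
pose m := Num.min 1 (- x2).
have m0 : 0 < m by rewrite lt_min ltr01; lra.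
have m1 : m <= 1 by rewrite ge_min lexx.
have mx : m <= - x2 by rewrite ge_min lexx orbT.
have e : line p0 p1 (1 - m) = p1.
  apply: disj; first by apply/segP; exists (1 - m) => //; lra.
  apply/segP; exists (m / - x2).
    by rewrite divr_ge0 ?ler_pdivrMr //=; lra.
  have x2n0 : x2 != 0 by rewrite lt_eqF.
  by rewrite p2E; apply: plane_eq => /=; rewrite dE /=; field.
have := e; rewrite -[RHS](line1 p0) => /(line_inj p01); lra.
Qed.

(** For [h > 0] it is 0 up to [-1 - h], rises to 1 at -1, equals [- x] on [-1, 0] and is 0
    afterwards. Hence [x + tent h x] is 0 on [-1, 0] and strictly increasing on either side. *)
Definition tent (h x : R) : R := Num.max 0 (Num.min (- x) ((x + 1) / h + 1)).

Lemma tent_decr (h x x' : R) : 0 < h -> x < x' -> tent h x - tent h x' <= x' - x.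
Proof.
move=> h0 xx; have : (x + 1) / h < (x' + 1) / h by rewrite ltr_pM2r ?invr_gt0 //; lra.
rewrite /tent; move: ((x + 1) / h) ((x' + 1) / h) => a a' aa.
by case: (leP (- x)) => ?; case: (leP 0) => ?; case: (leP (- x')) => ?;
  case: (leP 0) => ?; lra.
Qed.

Lemma tent_flat (h x x' : R) : 0 < h -> x < x' -> x + tent h x = x' + tent h x' ->
  -1 <= x /\ x' <= 0.
Proof.
move=> h0 xx; have : (x + 1) / h < (x' + 1) / h by rewrite ltr_pM2r ?invr_gt0 //; lra.
(* The quotients are about to be generalized for [lra], so the needed facts on their signs are
   recorded. *)
have : (x + 1) / h < 0 \/ -1 <= x.
  have [|xn] := leP (-1) x; first by right.
  by left; rewrite pmulr_llt0 ?invr_gt0 //; lra.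
have : 0 <= (x' + 1) / h \/ x' < -1.
  have [xn|] := leP (-1) x'; last by right.
  by left; apply: divr_ge0; lra.
rewrite /tent; move: ((x + 1) / h) ((x' + 1) / h) => a a' aa ab ac.
by case: (leP (- x)) => ?; case: (leP 0) => ?; case: (leP (- x')) => ?;
  case: (leP 0) => ?; case: aa => ?; case: ab => ?; lra.
Qed.

(** The tent descends with slope at most 1, so [x + k * tent h x] is strictly increasing for
    [k < 1]; for [k = 1] it is flat on [-1, 0] only. *)
Lemma tent_inj (h k x x' : R) : 0 < h -> 0 <= k <= 1 ->
  x + k * tent h x = x' + k * tent h x' ->
  x = x' \/ [/\ k = 1, -1 <= x <= 0 & -1 <= x' <= 0].
Proof.
move=> h0 k01; wlog xx : x x' / x < x' => [hw e|e].
  have [xx|xx|->] := ltgtP x x'; last by left.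
    exact: hw.
  by have [->|[-> ? ?]] := hw _ _ xx (esym e); [left|right].
right; have := tent_decr h0 xx => td.
have k1 : k = 1 by nra.
have [x1 x'0] : -1 <= x /\ x' <= 0.
  by apply: tent_flat h0 xx _; rewrite k1 !mul1r in e.
by split => //; lra.
Qed.

(** Points move in the direction [p1 - p0] by a tent in [X], damped by the factor [k (Y z)]. Each
    parallel to the axis is mapped monotonically to itself, strictly unless [k (Y z) = 1], that is
    on the axis, where [-1, 0] goes to the origin. The set [K] is compact and stays off the support;
    the segment from [p1] touches the collapsed one and is fixed because the tent vanishes for
    [X >= 0]. *)
Lemma collapse_map p0 p1 p2 (K : set (R * R)) : p0 <> p1 -> compact K ->
  (forall z, seg p0 p1 z -> seg p1 p2 z -> z = p1) ->
  (forall z, seg p0 p1 z -> ~ K z) ->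
  exists c : R * R -> R * R, [/\ continuous c, c p0 = p1,
    forall z, seg p1 p2 z \/ K z -> c z = z &
    forall z z', c z = c z' -> z = z' \/ (seg p0 p1 z /\ seg p0 p1 z')].
Proof.
move=> p01 cK disj disjK.
have [X [Y [[cX cY] XYI XYm [X1 Y1] X2]]] := adapted_coords p01 disj.
have segXY z : Y z = 0 -> -1 <= X z <= 0 -> seg p0 p1 z.
  move=> Y0 X01; apply/segP; exists (1 + X z); first lra.
  have [Xm Ym] := XYm p1 (X z); apply: XYI.
    rewrite -[LHS]add0r -X1 -Xm; congr X; apply: plane_eq => /=; ring.
  by rewrite Y0 -Y1 -Ym; congr Y; apply: plane_eq => /=; ring.
have [X0 Y0] : X p0 = -1 /\ Y p0 = 0.
  have [Xm Ym] := XYm p1 (-1); rewrite -Y1 -Ym; split.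
    rewrite -[RHS]add0r -X1 -Xm; congr X; apply: plane_eq => /=; ring.
  by congr Y; apply: plane_eq => /=; ring.
(* In the coordinates [X], [Y] this is the distance to the segment for the maximum norm; its minimum
   on [K] is positive and serves as width [h]. *)
pose D z := Num.max `|Y z| (Num.max (-1 - X z) (X z)).
have [h h0 hK] : exists2 h : R, 0 < h & forall z, K z -> h <= D z.
  have [K0|K0] := pselect (K !=set0); last first.
    by exists 1 => // z Kz; case: K0; exists z.
  have [|q qK qm] := @compact_EVT_min _ _ D _ K0 cK.
    by apply: continuous_subspaceT; rewrite /D; cts.
  exists (D q); last by move=> z Kz; apply: qm; rewrite inE.
  rewrite ltNge; apply/negP; rewrite !ge_max normr_le0 => /andP[/eqP Yq /andP[Xa Xb]].
  by move: qK; rewrite inE; apply: disjK; apply: segXY => //; lra.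
pose k (y : R) : R := Num.max 0 (1 - `|y| / h).
pose m z := k (Y z) * tent h (X z).
pose c z := (z.1 + m z * (p1.1 - p0.1), z.2 + m z * (p1.2 - p0.2)).
have k01 (y : R) : 0 <= k y <= 1.
  rewrite /k le_max lexx ge_max ler01 /= gerBl.
  by apply: divr_ge0; rewrite ?normr_ge0 ?ltW.
have k1 (y : R) : k y = 1 -> y = 0.
  move=> e; have : `|y| / h <= 0.
    by move: e; rewrite /k; case: (leP 0) => ? ?; lra.
  by rewrite pmulr_lle0 ?invr_gt0 // normr_le0 => /eqP.
have tent0 (x : R) : 0 <= x \/ x <= -1 - h -> tent h x = 0.
  rewrite /tent => hx; apply: max_idPl; rewrite ge_min; apply/orP.
  case: hx => hx; [left; lra|right].
  rewrite -(@ler_pM2r _ h) // mulrDl divfK ?gt_eqF //; lra.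
have m0 z : seg p1 p2 z \/ K z -> m z = 0.
  rewrite /m => -[/X2 Xz|/hK]; first by rewrite tent0 ?mulr0 //; left.
  rewrite !le_max => /or3P[hY|hX|hX].
  - have -> : k (Y z) = 0; last by rewrite mul0r.
    apply: max_idPl; rewrite subr_le0 ler_pdivlMr // mul1r //.
  - by rewrite tent0 ?mulr0 //; right; lra.
  - by rewrite tent0 ?mulr0 //; left; lra.
exists c; split.
- have ck : continuous m by rewrite /m /k /tent; cts.
  by rewrite /c; cts.
- have mp0 : m p0 = 1.
    rewrite /m X0 Y0 /k /tent normr0 mul0r subr0 addNr mul0r add0r opprK.
    by rewrite minxx (max_idPr ler01) mulr1.
  by rewrite /c mp0; apply: plane_eq => /=; ring.
- by move=> z /m0 mz; rewrite /c mz; apply: plane_eq => /=; ring.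
- move=> z z' e; have [cX1 cY1] := XYm z (m z); have [cX2 cY2] := XYm z' (m z').
  have eY : Y z = Y z' by rewrite -cY1 -cY2; congr Y.
  have : X z + m z = X z' + m z' by rewrite -cX1 -cX2; congr X.
  rewrite /m -eY => /(tent_inj h0 (k01 _))[eX|[/k1 Yz Xz Xz']].
    by left; apply: XYI.
  by right; split; apply: segXY; rewrite // -eY.
Qed.

End Collapse.

(** * Making one edge a straight segment *)

Section Straighten.
Local Open Scope ring_scope.
Local Open Scope classical_set_scope.
Variables (R : realType) (T : finType).
Implicit Types (G H : sgraph T) (pt : T -> R * R) (A : {set T} -> set (R * R)).

(* Collapsing the first segment of the polygon slides [u] along the edge [e]. *)
Lemma pd_straighten G pt A e u v s : plane_drawing G pt A -> e \in eset G ->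
  e = [set u; v]%SET -> simple_polyline (pt u) s -> last (pt u) s = pt v ->
  A e = polyline (pt u) s ->
  exists pt' B, plane_drawing G pt' B /\ B e = seg (pt' u) (pt' v).
Proof.
elim: s pt A => [|p1 s IH] pt A D eG eE /=.
  move=> _ uv _; have : arc_between (A e) (pt u) (pt v).
    by rewrite eE; apply: pd_arc D _ _ _; rewrite -eE.
  by move=> /arc_neq.
case: s IH => [|p2 s] IH.
  move=> /= _ lE Ae; exists pt, A; split => //; rewrite Ae -lE.
  by apply/seteqP; split => z; [move=> [//|->]; exact: seg_end|left].
move=> [p01 disj sp] lE Ae; set p0 := pt u in p01 disj sp lE Ae.
have ue : u \in e by rewrite eE !inE eqxx.
have ve : v \in e by rewrite eE !inE eqxx orbT.
have uG := edge_mem eG ue; have vG := edge_mem eG ve.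
have p1K : ~ polyline p2 s p1.
  case: sp => p12 h _ p1s; apply: p12; apply: h => //; exact: seg_start.
have [|||c [cc cp0 cid cI]] := @collapse_map _ p0 p1 p2 (polyline p2 s) p01.
- exact: polyline_compact.
- by move=> z z1 z2; apply: disj => //; left.
- move=> z z1 z2; apply: p1K; rewrite -(disj z) //; first by right.
have segA z : seg p0 p1 z -> A e z by rewrite Ae; left.
have QA z : polyline p1 (p2 :: s) z -> A e z by rewrite Ae; right.
have vQ : polyline p1 (p2 :: s) (pt v) by rewrite -lE; right; exact: polyline_last.
have Vseg x : x \in vset G -> seg p0 p1 (pt x) -> x = u.
  move=> xG xs; have : x \in e by apply: (pd_pt D eG xG); exact: segA.
  rewrite eE !inE => /orP[/eqP//|/eqP xv]; exfalso.
  have vp1 : pt v = p1 by apply: disj => //; rewrite -xv.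
  by apply: p1K; rewrite -vp1 -lE; exact: polyline_last.
have Aseg f z : f \in eset G -> f != e -> A f z -> seg p0 p1 z -> z = p0.
  move=> fG fe fz zs; have [x xG zx] := pd_cross D fG eG fe fz (segA _ zs).
  by rewrite zx (Vseg x) // -zx.
(* The rest of the polygon is fixed by [c], so a value [c z] lying there is a fixed point; it equals
   [z] unless [z] is on the first segment. *)
have cQ z : polyline p1 (p2 :: s) (c z) -> polyline p1 (p2 :: s) z \/ seg p0 p1 z.
  move=> Qz; have /cI[zE|[]] : c (c z) = c z by apply: cid.
  - by left; rewrite -zE.
  - by right.
(* Of the first segment only the start is kept, so [c] is injective here; all vertices and the other
   edges are still included. *)
pose X := [set z | seg p0 p1 z -> z = p0].
have D' : plane_drawing G (fun x => c (pt x))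
    (fun f => if f == e then polyline p1 (p2 :: s) else c @` A f).
  apply: (@pd_map _ _ G pt A e u v X c _ D eG eE) => //.
  - exact: continuous_subspaceT.
  - by move=> x y Xx Xy /cI[//|[/Xx -> /Xy ->]].
  - by move=> x xG xs; rewrite (Vseg x).
  - by move=> f fG fe z fz; exact: Aseg fz.
  - rewrite -/p0 cp0 cid; last by case: vQ; [left|right].
    rewrite -lE; apply: (@simple_polyline_arc _ p1 (p2 :: s)) => //= e1.
    by apply: p1K; rewrite e1; exact: polyline_last.
  - move=> f z fG fe fz /cQ[/QA ez|zs].
      by have [x xG ->] := pd_cross D fG eG fe fz ez; exists x.
    by exists u => //; rewrite (Aseg f z).
  - move=> x xG /cQ[/QA|/(Vseg x xG) -> //]; exact: pd_pt D _ _ _ _.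
apply: IH D' eG eE _ _ _; rewrite ?eqxx -/p0 cp0 //.
by rewrite cid; [exact: lE|case: vQ; [left|right]].
Qed.

End Straighten.

(** * Opening a slit and inverting the plane in a diamond *)

Section SlitOpening.
Local Open Scope ring_scope.
Local Open Scope classical_set_scope.
Variable R : realType.
Implicit Types z : R * R.

Definition slit : set (R * R) := seg (0, -1) (0, 1).

Lemma slitP z : slit z <-> z.1 = 0 /\ `|z.2| <= 1.
Proof.
rewrite ler_norml; split=> [/segP[t t01 ->] /=|[z1 z2]]; first by split; lra.
by apply/segP; exists ((z.2 + 1) / 2); [lra|apply: plane_eq => /=; lra].
Qed.

(** Only the interior of the slit is removed: its two ends carry the ends of [e], where other edges
    may arrive. *)
Definition off_slit : set (R * R) := [set z | z.1 = 0 -> 1 <= `|z.2|].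

Definition slit_gap z : R := Num.max 0 (1 - `|z.2|).
Definition slit_abs z : R := Num.sg z.1 * (`|z.1| + slit_gap z).
Definition slit_inv z : R := (`|z.1| + Num.max 1 `|z.2|)^-1.

(* [(x, y)] is first moved horizontally to [(slit_abs z, y)], which opens the
   slit into the diamond |x| + |y| <= 1; the inversion with respect to the
   l1-norm [1 / slit_inv z] then brings the outside of the diamond inside, and
   adding [1 - |y|] pushes the diamond into the half-plane x >= 0. The factor [s]
   selects the side. *)
Definition open_slit (s : R) z : R * R :=
  (s * (slit_abs z * slit_inv z * slit_inv z + 1 -
        `|z.2| * slit_inv z * slit_inv z),
   z.2 * slit_inv z * slit_inv z).

Lemma slit_gap_ge0 z : 0 <= slit_gap z.
Proof. by rewrite le_max lexx. Qed.

Lemma slit_norm_ge1 z : 1 <= `|z.1| + Num.max 1 `|z.2|.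
Proof. by rewrite ler_wpDl // le_max lexx. Qed.

Lemma slit_inv_gt0 z : 0 < slit_inv z.
Proof. by rewrite invr_gt0 (lt_le_trans ltr01) // slit_norm_ge1. Qed.

Lemma slit_scale_norm z (a : R) :
  `|a * slit_inv z * slit_inv z| = `|a| * slit_inv z * slit_inv z.
Proof. by rewrite !normrM !(gtr0_norm (slit_inv_gt0 z)). Qed.

Lemma slit_absE z : off_slit z -> `|slit_abs z| = `|z.1| + slit_gap z.
Proof.
move=> oz; rewrite normrM normr_sg [`|_ + _|]ger0_norm; last first.
  by rewrite addr_ge0 ?slit_gap_ge0.
have [z1|_] := eqVneq z.1 0; last by rewrite mul1r.
rewrite mul0r z1 normr0 add0r /slit_gap (max_idPl _) //.
by rewrite subr_le0; exact: oz.
Qed.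

(** The gap and [|z.2|] add up to the maximum of 1 and [|z.2|], so the moved point has l1-norm
    [1 / slit_inv z]; two factors [slit_inv z] invert it. *)
Lemma slit_l1_norm z : off_slit z ->
  `|slit_abs z * slit_inv z * slit_inv z| + `|z.2 * slit_inv z * slit_inv z| =
  slit_inv z.
Proof.
move=> oz; rewrite !slit_scale_norm -!mulrDl slit_absE //.
rewrite (_ : _ + _ + _ = `|z.1| + Num.max 1 `|z.2|); last first.
  by rewrite /slit_gap -addrA addr_maxl add0r subrK maxC.
by rewrite divff ?mul1r // gt_eqF // (lt_le_trans ltr01) // slit_norm_ge1.
Qed.

Lemma slit_abs_inj z z' : slit_gap z = slit_gap z' -> off_slit z -> off_slit z' ->
  slit_abs z = slit_abs z' -> z.1 = z'.1.
Proof.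
move=> eg oz oz' e.
have n : `|z.1| = `|z'.1|.
  by apply: (addIr (slit_gap z)); rewrite {2}eg -!slit_absE // e.
have [z1|z1] := eqVneq z.1 0.
  by apply/eqP; rewrite z1 eq_sym -normr_eq0 -n z1 normr0.
have p : 0 < `|z.1| + slit_gap z by rewrite ltr_pwDl ?normr_gt0 ?slit_gap_ge0.
move: e; rewrite /slit_abs -n -eg => /(mulIf (lt0r_neq0 p)) sE.
by rewrite (numEsg z.1) (numEsg z'.1) sE n.
Qed.

(** The l1-norm of the inverted point gives back [slit_inv z], so the scaling can be cancelled;
    [slit_abs z] and the height then determine [z]. *)
Lemma open_slit_inj s z z' : s != 0 -> off_slit z -> off_slit z' ->
  open_slit s z = open_slit s z' -> z = z'.
Proof.
move=> s0 oz oz' [/(mulfI s0) e1 e2].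
have i0 := slit_inv_gt0 z; have i0' := slit_inv_gt0 z'.
have ny : `|z.2| * slit_inv z * slit_inv z = `|z'.2| * slit_inv z' * slit_inv z'.
  by have := congr1 Num.norm e2; rewrite !slit_scale_norm.
have {}e1 : slit_abs z * slit_inv z * slit_inv z =
    slit_abs z' * slit_inv z' * slit_inv z' by lra.
have ei : slit_inv z = slit_inv z'.
  by rewrite -(slit_l1_norm oz) -(slit_l1_norm oz') e1 e2.
rewrite -ei in e1 e2; have in0 := lt0r_neq0 i0.
have {e2}ey := mulIf in0 (mulIf in0 e2); have {e1}ea := mulIf in0 (mulIf in0 e1).
by apply: plane_eq => //; apply: slit_abs_inj => //; rewrite /slit_gap ey.
Qed.

(** Away from the slit the l1-norm exceeds 1, so the inverted point is inside the open diamond,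
    where abscissa plus [1 - |y|] is positive. The factor [s] occurs as a square. *)
Lemma open_slit_pos s z : s != 0 -> off_slit z -> ~ slit z ->
  0 < s * (open_slit s z).1.
Proof.
move=> s0 oz nz; rewrite /open_slit /= mulrA -expr2 pmulr_rgt0; last first.
  by rewrite lt_neqAle sqr_ge0 eq_sym sqrf_eq0 s0.
have i1 : slit_inv z < 1.
  rewrite invf_lt1 ?(lt_le_trans ltr01 (slit_norm_ge1 z)) //.
  rewrite lt_neqAle slit_norm_ge1 andbT; apply/eqP => e; apply: nz; apply/slitP.
  have m1 : 1 <= Num.max 1 `|z.2| by rewrite le_max lexx.
  have m2 : `|z.2| <= Num.max 1 `|z.2| by rewrite le_max lexx orbT.
  have z0 := normr_ge0 z.1; split; last by lra.
  by apply/eqP; rewrite -normr_le0; lra.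
have := slit_l1_norm oz; have i0 := slit_inv_gt0 z.
have -> : `|z.2 * slit_inv z * slit_inv z| = `|z.2| * slit_inv z * slit_inv z.
  by rewrite slit_scale_norm.
have := lerNnormlW (lexx `|slit_abs z * slit_inv z * slit_inv z|); lra.
Qed.

Lemma open_slit_end s (y : R) : `|y| = 1 -> open_slit s (0, y) = (0, y).
Proof.
move=> y1; rewrite /open_slit /slit_abs /slit_inv /= sgr0 normr0 y1.
rewrite !add0r maxxx invr1; apply: plane_eq => /=; lra.
Qed.

(** The sign jumps only at abscissa 0, where [off_slit z] makes the gap, and with it the modulus of
    [slit_abs], vanish. *)
Lemma slit_abs_cts z : off_slit z -> {for z, continuous slit_abs}.
Proof.
move=> oz.
have c1 : continuous (fun z : R * R => z.1) by cts.
have cg : continuous (fun z => `|z.1| + slit_gap z) by rewrite /slit_gap; cts.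
have [z1|z1] := eqVneq z.1 0.
  have a0 : slit_abs z = 0 by rewrite /slit_abs z1 sgr0 mul0r.
  have g0 : `|z.1| + slit_gap z = 0.
    rewrite z1 normr0 add0r; apply: max_idPl; rewrite subr_le0; exact: oz.
  apply/cvgrPdist_le => r r0; have /cvgrPdist_le/(_ r r0) := cg z.
  apply: filterS => y; rewrite a0 g0 !sub0r !normrN; apply: le_trans.
  rewrite normrM [leRHS]ger0_norm ?addr_ge0 ?slit_gap_ge0 //.
  rewrite [`|_ + _|]ger0_norm ?addr_ge0 ?slit_gap_ge0 //.
  by rewrite ler_piMl ?addr_ge0 ?slit_gap_ge0 // normr_sg lern1 leq_b1.
apply: (@cvgM _ _ (nbhs z) _ (fun y => Num.sg y.1)); last exact: cg.
apply: cvg_near_cst; move: z1; rewrite neq_lt => /orP[] z1.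
  apply: filterS (cvgr_lt _ (c1 z) _ z1) => y y1.
  by rewrite !ltr0_sg.
apply: filterS (cvgr_gt _ (c1 z) _ z1) => y y1.
by rewrite !gtr0_sg.
Qed.

Lemma open_slit_cts s : {within off_slit, continuous (open_slit s)}.
Proof.
apply/subspace_continuousP => z oz; apply: cvg_within_filter.
have ci : continuous slit_inv.
  move=> y; apply: cvgV.
    by rewrite gt_eqF // (lt_le_trans ltr01) // slit_norm_ge1.
  have c : continuous (fun z : R * R => `|z.1| + Num.max 1 `|z.2|) by cts.
  exact: c.
have cn : continuous (fun z : R * R => `|z.2| * slit_inv z * slit_inv z) by cts.
have c2 : continuous (fun z : R * R => z.2 * slit_inv z * slit_inv z) by cts.
have ca := slit_abs_cts oz.
apply: (@cvg_pair _ _ _ (nbhs z) (nbhs _) (nbhs _)); last exact: c2.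
apply: (@cvgM _ _ (nbhs z) _ (fun=> s)); first exact: cvg_cst.
apply: cvgB; last exact: cn.
apply: cvgD; last exact: cvg_cst.
by apply: cvgM; [apply: cvgM; [exact: ca|exact: ci]|exact: ci].
Qed.

End SlitOpening.
Arguments slit R : clear implicits.

(** * Drawings on one side of an edge, and the amalgam *)

Section HalfPlane.
Local Open Scope ring_scope.
Local Open Scope classical_set_scope.
Variables (R : realType) (T : finType).
Implicit Types (G H : sgraph T) (pt : T -> R * R) (A : {set T} -> set (R * R)).

Lemma pd_normalize G pt A e u v : plane_drawing G pt A -> e \in eset G ->
  e = [set u; v]%SET -> A e = seg (pt u) (pt v) ->
  exists pt' B, [/\ plane_drawing G pt' B, pt' u = (0, -1), pt' v = (0, 1) &
    B e = slit R].
Proof.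
move=> D eG eE Ae.
have /arc_neq uv : arc_between (A e) (pt u) (pt v).
  by rewrite eE; apply: pd_arc D _ _ _; rewrite -eE.
set p := pt u in uv Ae; set q := pt v in uv Ae.
have [d dE] : exists d : R * R, d = (q.1 - p.1, q.2 - p.2) by eexists.
have d0 : d.1 * d.1 - d.2 * (- d.2) != 0.
  rewrite mulrN opprK paddr_eq0 -?expr2 ?sqr_ge0 // !sqrf_eq0.
  apply/negP => /andP[/eqP d1 /eqP d2]; apply: uv.
  by apply: plane_eq; [move: d1|move: d2]; rewrite dE /=; lra.
have [X [Y [cX cY XYE XYP]]] := @affine_coords R p d (- d.2, d.1) d0.
(* Along the edge [X] runs from 0 to 1 and [Y] vanishes, so the edge becomes the slit. *)
pose h z : R * R := (Y z, 2 * X z - 1).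
have [Xp Yp] : X p = 0 /\ Y p = 0.
  have := XYP 0 0; rewrite (_ : (_, _) = p) //.
  by apply: plane_eq => /=; ring.
have [Xq Yq] : X q = 1 /\ Y q = 0.
  have := XYP 1 0; rewrite (_ : (_, _) = q) //.
  by apply: plane_eq => /=; rewrite dE /=; ring.
have hp : h p = (0, -1) by apply: plane_eq => /=; lra.
have hq : h q = (0, 1) by apply: plane_eq => /=; lra.
have hI z z' : h z = h z' -> z = z'.
  move=> [eY eX]; rewrite (XYE z) (XYE z') eY.
  by have -> : X z = X z' by lra.
have hs z : slit R (h z) -> A e z.
  move=> /slitP /= [Yz]; rewrite ler_norml => Xz.
  rewrite Ae; apply/segP; exists (X z); first lra.
  by rewrite {1}(XYE z) Yz dE; apply: plane_eq => /=; ring.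
exists (fun x => h (pt x)), (fun f => if f == e then slit R else h @` A f).
rewrite eqxx; split => //.
apply: (@pd_map _ _ G pt A e u v setT h _ D eG eE) => //.
- by apply: continuous_subspaceT; rewrite /h; cts.
- by move=> x y _ _ /hI.
- rewrite -/p -/q hp hq; apply: arc_seg => -[]; lra.
- move=> f z fG fe fz /hs ez; have [x xG ->] := pd_cross D fG eG fe fz ez.
  by exists x.
- by move=> x xG /hs; exact: pd_pt D _ _ _ _.
Qed.

(** The sign of [s] chooses the side, while the places of [u], [v] and [e] do not depend on it; this
    is what lets two such drawings be glued. *)
Lemma planar_half_plane (s : R) G e u v : s != 0 -> planar R G -> e \in eset G ->
  e = [set u; v]%SET ->
  exists pt B, [/\ plane_drawing G pt B, pt u = (0, -1) /\ pt v = (0, 1),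
    B e = slit R,
    forall f z, f \in eset G -> f != e -> B f z ->
      [\/ 0 < s * z.1, z = (0, -1) | z = (0, 1)] &
    forall x, x \in vset G -> x \notin e -> 0 < s * (pt x).1].
Proof.
move=> s0 /planar_plane_drawing[pt0 [A0 D0]] eG eE.
have [A1 [l [D1 sl ll Ae1]]] := pd_polygon D0 eG eE.
have [pt2 [A2 [D2 Ae2]]] := pd_straighten D1 eG eE sl ll Ae1.
have [pt [A [D pu pv Ae]]] := pd_normalize D2 eG eE Ae2.
have ue : u \in e by rewrite eE !inE eqxx.
have ve : v \in e by rewrite eE !inE eqxx orbT.
have uG := edge_mem eG ue; have vG := edge_mem eG ve.
have Vslit x : x \in vset G -> slit R (pt x) -> x \in e.
  by move=> xG; rewrite -Ae; exact: (pd_pt D eG xG).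
have Veoff x : x \in e -> off_slit (pt x).
  by rewrite eE !inE => /orP[] /eqP ->; rewrite ?pu ?pv /off_slit /= ?normrN normr1.
(* A vertex inside the slit would be an end of [e], but those sit at the ends of the slit. *)
have Voff x : x \in vset G -> off_slit (pt x).
  move=> xG z1; rewrite leNgt; apply/negP => z2.
  have /Veoff/(_ z1) : x \in e by apply: Vslit => //; apply/slitP; rewrite ltW.
  by rewrite leNgt z2.
have Aslit f z : f \in eset G -> f != e -> A f z -> slit R z ->
    exists2 x, x \in vset G & z = pt x.
  by move=> fG fe fz zs; apply: (pd_cross D fG eG fe fz); rewrite Ae.
have Aoff f z : f \in eset G -> f != e -> A f z -> off_slit z.
  move=> fG fe fz z1; rewrite leNgt; apply/negP => z2.
  have [|x xG zx] := Aslit f z fG fe fz; first by apply/slitP; rewrite ltW.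
  by have := Voff x xG; rewrite -zx => /(_ z1); rewrite leNgt z2.
have ends z : slit R z -> off_slit z -> z = (0, -1) \/ z = (0, 1).
  move=> /slitP[z1 z2] oz; have z3 := oz z1.
  have : `|z.2| = 1 by apply/eqP; rewrite eq_le z2.
  move=> /eqP; rewrite eqr_norml ler01 andbT => /orP[] /eqP z4; [right|left];
    exact: plane_eq.
have fixu : open_slit s (0, -1) = (0, -1).
  by apply: open_slit_end; rewrite normrN normr1.
have fixv : open_slit s (0, 1) = (0, 1) by apply: open_slit_end; rewrite normr1.
have slitQ z : off_slit z -> slit R (open_slit s z) -> slit R z.
  move=> oz /slitP[z1 _]; apply: contrapT => nz.
  by have := open_slit_pos s0 oz nz; rewrite z1 mulr0 ltxx.
exists (fun x => open_slit s (pt x)),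
  (fun f => if f == e then slit R else open_slit s @` A f).
rewrite eqxx pu pv; split => //.
- apply: (@pd_map _ _ G pt A e u v (@off_slit R) _ _ D eG eE) => //.
  + exact: open_slit_cts.
  + by move=> x y ox oy; exact: open_slit_inj.
  + by move=> f fG fe z; exact: Aoff.
  + by rewrite pu pv fixu fixv; apply: arc_seg => -[]; lra.
  + move=> f z fG fe fz /(slitQ _ (Aoff _ _ fG fe fz)) zs.
    by have [x xG ->] := Aslit _ _ fG fe fz zs; exists x.
  + by move=> x xG /(slitQ _ (Voff _ xG)); exact: Vslit.
- move=> f y fG fe; rewrite (negPf fe) => -[z fz <-].
  have oz := Aoff _ _ fG fe fz; have [zs|zs] := pselect (slit R z).
    by have [->|->] := ends z zs oz; [constructor 2|constructor 3].
  by constructor 1; exact: open_slit_pos.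
- move=> x xG xe; apply: open_slit_pos => //; first exact: Voff.
  by move=> /(Vslit _ xG); apply/negP.
Qed.

Lemma planar_amalgam H1 H2 e : planar R H1 -> planar R H2 ->
  e \in eset H1 -> e \in eset H2 -> vset H1 :&: vset H2 = e ->
  planar R (gunion H1 H2).
Proof.
move=> P1 P2 e1 e2 VI; have [u [v [_ eE _ _]]] := edge2P e1.
have n1 : (-1 : R) != 0 by rewrite oppr_eq0 oner_eq0.
have [pt1 [B1 [D1 [u1 v1] Be1 S1 V1]]] := planar_half_plane (oner_neq0 R) P1 e1 eE.
have [pt2 [B2 [D2 [u2 v2] Be2 S2 V2]]] := planar_half_plane n1 P2 e2 eE.
(* The drawings agree on the common vertices and on [e], so the priority given to [H1] is harmless:
   see [ptE2] and [BE2]. *)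
pose pt x := if x \in vset H1 then pt1 x else pt2 x.
pose B f := if f \in eset H1 then B1 f else B2 f.
have ptE1 x : x \in vset H1 -> pt x = pt1 x by rewrite /pt => ->.
have ptE2 x : x \in vset H2 -> pt x = pt2 x.
  rewrite /pt; case: ifPn => // x1 x2.
  have : x \in e by rewrite -VI inE x1.
  by rewrite eE !inE => /orP[] /eqP ->; rewrite ?u1 ?u2 ?v1 ?v2.
have EI f : f \in eset H1 -> f \in eset H2 -> f = e.
  move=> f1 f2; apply/eqP; rewrite eqEcard (edge_card f1) (edge_card e1) leqnn andbT.
  by rewrite -VI finset.subsetI (edge_sub f1) (edge_sub f2).
have BE1 f : f \in eset H1 -> B f = B1 f by rewrite /B => ->.
have BE2 f : f \in eset H2 -> B f = B2 f.
  by rewrite /B; case: ifPn => // f1 /(EI _ f1) ->; rewrite Be1 Be2.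
have U1 f z : f \in eset H1 -> B1 f z -> 0 <= z.1.
  move=> f1; have [->|fe] := eqVneq f e.
    by rewrite Be1 => /slitP[-> _].
  by move=> /(S1 _ _ f1 fe)[|->|->] //=; rewrite mul1r => /ltW.
have U2 f z : f \in eset H2 -> B2 f z -> z.1 <= 0.
  move=> f2; have [->|fe] := eqVneq f e.
    by rewrite Be2 => /slitP[-> _].
  by move=> /(S2 _ _ f2 fe)[|->|->] //=; rewrite mulN1r oppr_gt0 => /ltW.
have W1 x : x \in vset H1 -> x \notin vset H2 -> 0 < (pt1 x).1.
  move=> x1 x2; rewrite -[ltRHS]mul1r; apply: V1 => //.
  by rewrite -VI inE x1.
have W2 x : x \in vset H2 -> x \notin vset H1 -> (pt2 x).1 < 0.
  move=> x2 x1; rewrite -oppr_gt0 -mulN1r; apply: V2 => //.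
  by rewrite -VI inE (negPf x1).
have uG : u \in vset H1 by apply: (edge_mem e1); rewrite eE !inE eqxx.
have vG : v \in vset H1 by apply: (edge_mem e1); rewrite eE !inE eqxx orbT.
(* Points common to both sides have abscissa 0, where an edge of [H1] other than [e] has at most the
   ends of [e]. *)
have cross f g z : f \in eset H1 -> g \in eset H2 -> f != g ->
    B1 f z -> B2 g z -> exists2 x, x \in vset H1 :|: vset H2 & z = pt x.
  move=> f1 g2 fg fz gz; have [fe|fe] := eqVneq f e.
    have ez : B2 e z by rewrite Be2 -Be1 -fe.
    have [|x x2 ->] := pd_cross D2 e2 g2 _ ez gz; first by rewrite -fe.
    by exists x; rewrite ?inE ?x2 ?orbT ?ptE2.
  have z0 := U2 _ _ g2 gz.
  case: (S1 _ _ f1 fe fz) => [|->|->]; first by rewrite mul1r ltNge z0.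
    by exists u; rewrite ?inE ?uG ?ptE1.
  by exists v; rewrite ?inE ?vG ?ptE1.
apply: (@plane_drawing_planar _ _ _ pt B); split => /=.
- have key x y : x \in vset H1 -> y \in vset H2 -> pt x = pt y -> x = y.
    move=> x1 y2; have [x2|x2] := boolP (x \in vset H2).
      by rewrite !ptE2 // => /(pd_inj D2); apply.
    have [y1|y1] := boolP (y \in vset H1).
      by rewrite !ptE1 // => /(pd_inj D1); apply.
    rewrite ptE1 // ptE2 // => e'; have := W1 _ x1 x2.
    by rewrite e' ltNge ltW // W2.
  move=> x y; rewrite !inE => /orP[] x1 /orP[] y1.
  + by rewrite !ptE1 // => /(pd_inj D1); apply.
  + exact: key.
  + by move=> e'; symmetry; apply: key.
  + by rewrite !ptE2 // => /(pd_inj D2); apply.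
- move=> u' v'; rewrite inE => /orP[] fG.
    by rewrite BE1 // !ptE1 ?(edge_mem fG) ?inE ?eqxx ?orbT //; exact: pd_arc D1 _ _ _.
  by rewrite BE2 // !ptE2 ?(edge_mem fG) ?inE ?eqxx ?orbT //; exact: pd_arc D2 _ _ _.
- move=> f x; rewrite !inE => /orP[] fG.
    rewrite BE1 //; have [x1 _|x1 /= x2] := boolP (x \in vset H1).
      by rewrite ptE1 //; exact: pd_pt D1 _ _ _ _.
    by rewrite ptE2 // => /(U1 _ _ fG); rewrite leNgt W2.
  rewrite BE2 // orbC; have [x2 _|x2 /= x1] := boolP (x \in vset H2).
    by rewrite ptE2 //; exact: pd_pt D2 _ _ _ _.
  by rewrite ptE1 // => /(U2 _ _ fG); rewrite leNgt W1.
- move=> f g z; rewrite !inE => /orP[] fG /orP[] gG fg.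
  + rewrite !BE1 // => fz gz; have [x x1 ->] := pd_cross D1 fG gG fg fz gz.
    by exists x; rewrite ?inE ?x1 ?ptE1.
  + by rewrite BE1 // BE2 //; exact: cross.
  + by rewrite BE2 // BE1 // => fz gz; apply: (cross g f) => //; rewrite eq_sym.
  + rewrite !BE2 // => fz gz; have [x x2 ->] := pd_cross D2 fG gG fg fz gz.
    by exists x; rewrite ?inE ?x2 ?orbT ?ptE2.
Qed.

End HalfPlane.

(** * Decompositions as edge colourings, and the two bounds *)

Section Colourings.
Variables (R : realType) (T : finType).
Implicit Types (G : sgraph T) (c : {set T} -> nat).

Lemma edge_class_subproof G c i :
  [forall f in [set f in eset G | c f == i], (#|f| == 2) && (f \subset vset G)].
Proof.
apply/forall_inP => f; rewrite inE => /andP[fG _].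
by rewrite (edge_card fG) (edge_sub fG).
Qed.

Definition edge_class G c i : sgraph T := SGraph (edge_class_subproof G c i).

(** With colours the classes are disjoint and cover the edges by construction; values outside
    [eset G] are ignored. *)
Definition planar_colouring G k c :=
  (forall f, f \in eset G -> c f < k) /\
  (forall i, i < k -> planar R (edge_class G c i)).

Lemma planar_decomposableP G k :
  planar_decomposable R G k <-> exists c, planar_colouring G k c.
Proof.
split=> [[H [Hs Hp Hd Hc]]|[c [ck cP]]].
  pose c (f : {set T}) : nat :=
    if [pick i | f \in eset (H i)] is Some i then nat_of_ord i else 0.
  have cE f : f \in eset G -> exists2 i : 'I_k, c f = i & f \in eset (H i).
    rewrite -Hc => /finset.bigcupP[j _ fj]; rewrite /c.
    by case: pickP => [i fi|/(_ j)]; [exists i|rewrite fj].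
  exists c; split=> [f /cE[i -> _]|i ik]; first exact: ltn_ord.
  apply: planar_eset_sub (Hp (Ordinal ik)); apply/fintype.subsetP => f.
  rewrite inE => /andP[/cE[j -> fj] /eqP ji].
  by rewrite (_ : Ordinal ik = j) //; apply: val_inj.
exists (fun i : 'I_k => edge_class G c i); split => /=.
- move=> i; rewrite /spanning_subgraph /= eqxx /=.
  by apply/fintype.subsetP => f; rewrite inE => /andP[].
- by move=> i; exact: cP.
- move=> i j ij; apply/pred0P => f /=; rewrite !inE.
  apply/negP => /andP[/andP[_ /eqP ci] /andP[_ /eqP cj]].
  by case/eqP: ij; apply: val_inj; rewrite /= -ci -cj.
- apply/finset.setP => f; apply/finset.bigcupP/idP => [[i _]|fG].
    by rewrite inE => /andP[].
  by exists (Ordinal (ck f fG)); rewrite // inE fG /=.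
Qed.

Lemma thickness_colouring G : exists c, planar_colouring G (thickness R G) c.
Proof.
apply/planar_decomposableP; rewrite /thickness.
by case: ex_minnP => m /asboolP.
Qed.

Lemma thickness_le G k c : planar_colouring G k c -> thickness R G <= k.
Proof.
move=> ck; rewrite /thickness; case: ex_minnP => m _; apply.
by apply/asboolP/planar_decomposableP; exists c.
Qed.

(** An optimal colouring of [G] also colours [H], with smaller classes. *)
Lemma thickness_subgraph G H : eset H \subset eset G ->
  thickness R H <= thickness R G.
Proof.
move=> HG; have [c [ck cP]] := thickness_colouring G.
apply: (@thickness_le _ _ c); split=> [f fH|i /cP].
  exact/ck/(fintype.subsetP HG).
apply: planar_eset_sub; apply/fintype.subsetP => f; rewrite !inE.
by move=> /andP[/(fintype.subsetP HG) -> ->].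
Qed.

(* The colour of [e] in [c2] is merged with its colour in [c1]; the other
   colours of [c2] are renumbered from [n1] on. *)
Lemma planar_colouring_amalgam G1 G2 e n1 n2 c1 c2 :
  e \in eset G1 -> e \in eset G2 -> vset G1 :&: vset G2 = e ->
  planar_colouring G1 n1 c1 -> planar_colouring G2 n2 c2 ->
  exists c, planar_colouring (gunion G1 G2) (n1 + n2 - 1) c.
Proof.
move=> e1 e2 VI [k1 P1] [k2 P2].
(* As [e] has a colour on both sides, [n1] and [n2] are positive and the truncated subtraction is
   exact. *)
have a1 := k1 _ e1; have a2 := k2 _ e2.
pose c f := if f \in eset G1 then c1 f else
  if c2 f == c2 e then c1 e else
  if c2 f < c2 e then n1 + c2 f else n1 + (c2 f).-1.
exists c; split=> [f|i ik].
  rewrite inE /c; case: ifPn => /= [f1 _|f1 f2]; first by have := k1 _ f1; lia.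
  by have := k2 _ f2; case: eqP; case: (ltnP (c2 f) (c2 e)); lia.
have [ie|ie] := eqVneq i (c1 e).
  (* The class of [e] in the union lies in the amalgam of the two classes of [e]; these are
     spanning, so they share just the vertices of [e]. *)
  pose K1 := edge_class G1 c1 (c1 e); pose K2 := edge_class G2 c2 (c2 e).
  have P : planar R (gunion K1 K2).
    apply: (@planar_amalgam _ _ _ _ e) => //=; first exact: P1.
    - exact: P2.
    - by rewrite inE e1 eqxx.
    - by rewrite inE e2 eqxx.
  apply: planar_eset_sub P; apply/fintype.subsetP => f; rewrite !inE ie /c.
  case: ifPn => /= [_ ->//|f1 /andP[f2]]; rewrite f2 /=.
  by case: (c2 f =P c2 e) => // n; case: (ltnP (c2 f) (c2 e)); lia.
have [i1|i1] := ltnP i n1.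
  apply: planar_eset_sub (P1 _ i1); apply/fintype.subsetP => f; rewrite !inE /c.
  case: ifPn => //= f1 /andP[f2].
  case: (c2 f =P c2 e) => [_|n]; first by rewrite eq_sym (negPf ie).
  by case: (ltnP (c2 f) (c2 e)); lia.
(* Inverse of the renumbering, jumping over the colour of [e]. *)
pose j := if i - n1 < c2 e then i - n1 else (i - n1).+1.
have jn : j < n2 by rewrite /j; case: (ltnP (i - n1)); lia.
apply: planar_eset_sub (P2 _ jn); apply/fintype.subsetP => f; rewrite !inE /c.
case: ifPn => /= [f1|f1 /andP[f2]]; first by have := k1 _ f1; lia.
rewrite f2 /= /j; case: (c2 f =P c2 e) => [_|n]; first by rewrite eq_sym (negPf ie).
by case: (ltnP (c2 f) (c2 e)); case: (ltnP (i - n1)); lia.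
Qed.

End Colourings.

Theorem theorem2p3 (R : realType) (T : finType) (G G1 G2 : sgraph T)
    (e : {set T}) (n1 n2 : nat)
    (subG1 : subgraph G1 G) (subG2 : subgraph G2 G)
    (GU : G = gunion G1 G2)
    (eG : e \in eset G)
    (VI : vset (ginter G1 G2) = e)
    (EI : eset (ginter G1 G2) = [set e]%SET)
    (th1 : thickness R G1 = n1) (th2 : thickness R G2 = n2) :
  maxn n1 n2 <= thickness R G <= n1 + n2 - 1.
Proof.
have /finset.setIP[e1 e2] : e \in eset G1 :&: eset G2.
  by rewrite -[_ :&: _]/(eset (ginter G1 G2)) EI finset.set11.
apply/andP; split.
  rewrite geq_max -th1 -th2 !thickness_subgraph //.
    by case/andP: subG2.
  by case/andP: subG1.
have [c1 C1] := thickness_colouring R G1; have [c2 C2] := thickness_colouring R G2.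
rewrite th1 in C1; rewrite th2 in C2.
have [c cC] := planar_colouring_amalgam e1 e2 VI C1 C2.
by rewrite GU; exact: thickness_le cC.
Qed.
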